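(* Let $n\in\mathbb N$, let $A$ be a Young function with $A(t)\sim t^n(\log t)^q$ near infinity for some $q>n-1$, and let $\varphi$ be a gauge function with $\varphi(r)\sim(\log\frac1r)^\beta$ near zero for some $\beta<0$. Set $\sigma=\frac{n\beta}{n-q-1+\beta}$, let $\mu>1+\sigma$, and let $\phi$ be a gauge function with $\phi(r)\sim r^\sigma(\log\frac1r)^\mu$ near zero. Then there exist a map $u\in V^{1,A}(\mathbb R^n,\mathbb R^n)$ and a compact set $E\subset\mathbb R^n$ such that $0<\mathscr H^\varphi(E)<\infty$ and $\mathscr H^\phi(u(E))=\infty$.
   Context: A gauge function is an increasing continuous function $\phi\colon[0,\infty)\to[0,\infty)$ vanishing only at $0$. For $E\subset\mathbb R^k$, $\mathscr H^\phi(E)=\lim_{\sigma\to0^+}\inf\{\sum_i\phi(d(E_i)): d(E_i)\le\sigma, E\subset\bigcup_iE_i\}$ ($d$ = diameter). A Young function is a non-trivial convex $A\colon[0,\infty)\to[0,\infty]$ with $A(0)=0$; $L^A$ is the Orlicz space with Luxemburg norm $\|f\|_{L^A}=\inf\{\lambda>0:\int A(|f|/\lambda)\le1\}$, and $V^{1,A}(\mathbb R^n,\mathbb R^n)$ is the space of weakly differentiable $u\in L^1_{\rm loc}$ with $|\nabla u|\in L^A(\mathbb R^n)$ (continuous representative used). ''$f\sim g$ near zero (near infinity)'' means $c^{-1}g\le f\le cg$ on some interval $(0,r_0)$ (on some $(t_0,\infty)$) for a constant $c>0$. *)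

(* Defs.v *)
From HB Require Import structures.
From mathcomp Require Import all_boot all_order all_algebra.
From mathcomp Require Import all_classical all_reals all_analysis.
Set Implicit Arguments. Unset Strict Implicit. Unset Printing Implicit Defensive.
Import Order.TTheory GRing.Theory Num.Theory.
Import numFieldNormedType.Exports.
Local Open Scope classical_set_scope.
Local Open Scope ring_scope.

Section Defs.
Variable R : realType.

Definition edist (n : nat) (x y : 'rV[R]_n) : R :=
  Num.sqrt (\sum_(i < n) (x ord0 i - y ord0 i) ^+ 2).

(* Euclidean diameter; the diameter of the empty set is 0. *)
Definition ediam (n : nat) (E : set 'rV[R]_n) : \bar R :=
  ereal_sup ([set 0%:E] `|` [set (edist x y)%:E | x in E & y in E]).

Definition gauge (phi : R -> R) : Prop :=
  phi 0 = 0 /\ (forall r, 0 < r -> 0 < phi r) /\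
  (forall r s, 0 <= r -> r <= s -> phi r <= phi s) /\
  {within [set r : R | 0 <= r], continuous phi}.

Definition hausdorff_pre (n : nat) (phi : R -> R) (delta : R)
    (E : set 'rV[R]_n) : \bar R :=
  ereal_inf [set (\sum_(i <oo) (phi (fine (ediam (F i))))%:E)%E |
     F in [set F : nat -> set 'rV[R]_n |
            (forall i, (ediam (F i) <= delta%:E)%E) /\ E `<=` \bigcup_i F i]].

(* H^phi(E) = lim_{delta -> 0+} H^phi_delta(E), the limit of a nonincreasing
   function of delta, i.e. its supremum over delta > 0 *)
Definition hausdorff (n : nat) (phi : R -> R) (E : set 'rV[R]_n) : \bar R :=
  ereal_sup [set hausdorff_pre phi delta E | delta in [set d : R | 0 < d]].

Definition sim_near_zero (f g : R -> R) : Prop :=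
  exists c r0 : R, 0 < c /\ 0 < r0 /\
    forall r, 0 < r < r0 -> c^-1 * g r <= f r /\ f r <= c * g r.

Definition esim_near_infty (f : R -> \bar R) (g : R -> R) : Prop :=
  exists c t0 : R, 0 < c /\
    forall t, t0 < t -> ((c^-1 * g t)%:E <= f t /\ f t <= (c * g t)%:E)%E.

Definition young (A : R -> \bar R) : Prop :=
  A 0 = 0%E /\ (forall t, 0 <= t -> (0 <= A t)%E) /\
  (forall s t l : R, 0 <= s -> 0 <= t -> 0 <= l <= 1 ->
     (A (l * s + (1 - l) * t)%R <= l%:E * A s + (1 - l)%R%:E * A t)%E) /\
  (exists t, 0 < t /\ (0 < A t)%E) /\ (exists t, 0 < t /\ (A t < +oo)%E).

(* n-fold iterated Lebesgue integral (Fubini/Tonelli construction of the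
   Lebesgue integral on R^n, not available in the library) *)
Fixpoint iter_int (k : nat) (g : seq R -> \bar R) : \bar R :=
  match k with
  | 0 => g [::]
  | k'.+1 => (\int[@lebesgue_measure R]_(x in setT)
                iter_int k' (fun s => g (x :: s)))%E
  end.

Definition int_Rn (n : nat) (f : 'rV[R]_n -> \bar R) : \bar R :=
  iter_int n (fun s => f (\row_(i < n) nth 0 s i)).

Definition borel_Rn (n : nat) : set (set 'rV[R]_n) := <<s @open 'rV[R]_n >>.

Definition borel_fun (n : nat) (f : 'rV[R]_n -> R) : Prop :=
  forall B : set R, measurable B -> borel_Rn (f @^-1` B).

Definition loc_integrable (n : nat) (f : 'rV[R]_n -> R) : Prop :=
  borel_fun f /\
  forall K : set 'rV[R]_n, compact K ->
    (int_Rn (fun x => (\1_K x * `|f x|)%:E) < +oo)%E.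

Fixpoint smooth_k (n : nat) (k : nat) (f : 'rV[R]_n -> R) : Prop :=
  match k with
  | 0 => continuous f
  | k'.+1 => (forall x, differentiable f x) /\
             (forall v : 'rV[R]_n, smooth_k k' ('D_v f))
  end.

Definition test_fun (n : nat) (psi : 'rV[R]_n -> R) : Prop :=
  (forall k, smooth_k k psi) /\ compact (closure [set x | psi x != 0]).

Definition basis_vec (n : nat) (j : 'I_n) : 'rV[R]_n := delta_mx ord0 j.

Definition weak_gradient (n : nat) (u : 'rV[R]_n -> 'rV[R]_n)
    (G : 'rV[R]_n -> 'M[R]_n) : Prop :=
  (forall i, loc_integrable (fun x => u x ord0 i)) /\
  (forall i j, loc_integrable (fun x => G x i j)) /\
  forall psi, test_fun psi -> forall i j,
    int_Rn (fun x => (u x ord0 i * ('D_(basis_vec j) psi) x)%:E) =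
    (- int_Rn (fun x => (G x i j * psi x)%:E))%E.

Definition frob_norm (n : nat) (M : 'M[R]_n) : R :=
  Num.sqrt (\sum_(i < n) \sum_(j < n) M i j ^+ 2).

(* f in the Orlicz space L^A(R^n): finite Luxemburg norm *)
Definition in_orlicz (n : nat) (A : R -> \bar R) (f : 'rV[R]_n -> R) : Prop :=
  borel_fun f /\
  exists lam : R, 0 < lam /\ (int_Rn (fun x => A (`|f x| / lam)%R) <= 1)%E.

(* u in V^{1,A}(R^n,R^n), u being its continuous representative *)
Definition V1A (n : nat) (A : R -> \bar R) (u : 'rV[R]_n -> 'rV[R]_n) : Prop :=
  continuous u /\
  exists G, weak_gradient u G /\ in_orlicz A (fun x => frob_norm (G x)).

End Defs.

(* Main.v *)
(** [E] is a Cantor set on a coordinate axis.  Its pieces of generation [k] are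
    indexed by the binary words of length [k] and have size [del k = 2^-M_k]
    with [M_k] comparable to [2^(k/|beta|)], so that [2^k varphi(del k)] is
    bounded above and below.  The map is
      [u = sum_k s_k W_k e_(k mod n)],  [s_k = 2^(-k/sigma) (k+1)^-(1+1/sigma)],
    where the cutoff [W_k] equals the [k]-th binary digit on [E].  It is an
    average of [J_k], about [2^(k/|beta|)], bumps rescaled by consecutive powers
    of 2, which reproduces the gradient [1/(J_k |x|)] of the extremal functions
    of logarithmic capacity.  The gradients live on shells which are pairwise
    disjoint over all generations and scales, so the energy is a sum over the
    shells.  Since [n/sigma = 1 + (q-n+1)/|beta|], generation [k] contributes
    [O(2^k s_k^n J_k^(q-n+1)) = O((k+1)^-2)].

    [u(E)] is a Cantor set whose pieces of generation [k] are separated by a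
    multiple of [s_k], and [2^k phi(s_k)] is of order [(k+1)^(mu-1-sigma)],
    which tends to infinity; the mass distribution principle concludes. *)

Require Import Defs.
From HB Require Import structures.
From mathcomp Require Import all_boot all_order all_algebra.
From mathcomp Require Import all_classical all_reals all_analysis.
From mathcomp Require Import measurable_realfun.
From mathcomp Require Import ring lra zify.
Set Implicit Arguments. Unset Strict Implicit. Unset Printing Implicit Defensive.
Import Order.TTheory GRing.Theory Num.Theory.
Import numFieldNormedType.Exports.
Local Open Scope classical_set_scope.
Local Open Scope ring_scope.

(** * Integrals of functions that need not be measurable *)

(** Why the coordinates take turns: a binary sum separates words when its terms decrease by a ratio
    below 1/2, but consecutive [s_k] have ratio about [2^(-1/sigma)], possibly above 1/2. Along a
    single coordinate the ratio is about [2^(-n/sigma)], and [q > n-1] gives [sigma < n].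

    Why the factor [(k+1)^-(1+1/sigma)]: it leaves [2^k s_k^sigma = (k+1)^-(1+sigma)], which the
    logarithm in [phi] has to beat with [(k+1)^mu]; hence the threshold on [mu]. In the energy it
    leaves [(k+1)^-(n+n/sigma)], where [n+n/sigma >= 2].

    The obstacle on the analytic side is that [int_Rn] is an iterated integral whose inner integrals
    are uncontrolled on null sets. It is matched with a measure on Borel sets that is invariant
    under coordinate translations. Invariance yields integration by parts, since integrals of
    difference quotients vanish; a second-order remainder suffices for this, so a piecewise
    quadratic cutoff will do. Disjoint shells keep every partial sum of the gradient below the limit
    in absolute value, so dominated convergence needs no other majorant. *)

Section Integral.
Context d (T : measurableType d) (R : realType) (mu : {measure set T -> \bar R}).
Local Open Scope ereal_scope.
Import HBNNSimple.

(** The integral of a nonnegative function is a supremum over the simple functions below it, and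
    that set grows with the function. This permits comparison under an iterated integral, where the
    measurability of the inner integrals is unknown. *)
Lemma ge0_le_integral_any (f g : T -> \bar R) :
  (forall x, 0 <= f x) -> (forall x, f x <= g x) ->
  \int[mu]_x f x <= \int[mu]_x g x.
Proof.
move=> f0 fg; rewrite !ge0_integralTE//; last by move=> x; exact: le_trans (f0 x) (fg x).
apply/ge_ereal_sup => _ /= [h hf <-]; apply: ereal_sup_ubound; exists h => //.
by move=> x; exact: le_trans (hf x) (fg x).
Qed.

(* Fubini only controls the inner integrals of an iterated integral almost
   everywhere; on the exceptional null set they take unknown values, so
   measurability in the outer variable is not available. *)
Lemma ge0_integral_null_le (N : set T) (f g : T -> \bar R) :
  measurable N -> mu N = 0 -> (forall x, 0 <= f x) -> (forall x, 0 <= g x) ->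
  (forall x, ~ N x -> f x = g x) ->
  \int[mu]_x f x <= \int[mu]_x g x.
Proof.
move=> mN N0 f0 g0 fg.
rewrite [leLHS]ge0_integralTE// [leRHS]ge0_integralTE//.
apply/ge_ereal_sup => _ /= [h hf <-]; apply: ereal_sup_ubound.
have mNC := measurableC mN.
(* The simple function is set to 0 on [N]: it then lies below [g] everywhere and keeps its
   integral. *)
exists (proj_nnsfun h mNC).
  move=> x; rewrite -mrestrict patchE; case: ifPn => [|_]; last exact: g0.
  by rewrite inE => Nx; rewrite -fg//; exact: hf.
rewrite -!integralT_nnsfun; apply: ae_eq_integral => //.
- exact/measurable_EFinP.
- exact/measurable_EFinP.
- exists N; split => // x /= /not_implyP [_ hx]; apply: contrapT => Nx; apply: hx.
  by rewrite -[mindic _ _]/(\1_(~` N)) indicE mem_set// mulr1.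
Qed.

Lemma integral_null_eq (N : set T) (f g : T -> \bar R) :
  measurable N -> mu N = 0 -> (forall x, ~ N x -> f x = g x) ->
  \int[mu]_x f x = \int[mu]_x g x.
Proof.
move=> mN N0 fg; rewrite integralE [RHS]integralE; congr (_ - _).
  apply/eqP; rewrite eq_le; apply/andP; split.
    apply: (ge0_integral_null_le mN N0) => // x Nx; by rewrite !funeposE fg.
  apply: (ge0_integral_null_le mN N0) => // x Nx; by rewrite !funeposE fg.
apply/eqP; rewrite eq_le; apply/andP; split.
  apply: (ge0_integral_null_le mN N0) => // x Nx; by rewrite !funenegE fg.
apply: (ge0_integral_null_le mN N0) => // x Nx; by rewrite !funenegE fg.
Qed.

End Integral.

Lemma iter_int_le (R : realType) (k : nat) (f g : seq R -> \bar R) :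
  (forall s, 0 <= f s)%E -> (forall s, f s <= g s)%E ->
  (iter_int k f <= iter_int k g)%E.
Proof.
elim: k f g => [|k IH] f g f0 fg //=.
have ge0 j (h : seq R -> \bar R) : (forall s, 0 <= h s)%E -> (0 <= iter_int j h)%E.
  by elim: j h => [|j IHj] h h0 //=; apply: integral_ge0 => x _; exact: IHj.
by apply: ge0_le_integral_any => x; [exact: ge0|exact: IH].
Qed.

Section Translation.
Variable R : realType.
Local Notation mu := (@lebesgue_measure R).

(** By uniqueness of Lebesgue measure: its image under the translation has the same values on
    half-open intervals. *)
Lemma lebesgue_translation (h : R) (A : set (measurableTypeR R)) : measurable A ->
  mu ((fun x : measurableTypeR R => x + h : measurableTypeR R) @^-1` A) = mu A.
Proof.
move=> mA; pose tau (x : measurableTypeR R) : measurableTypeR R := x + h.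
have mtau : @measurable_fun _ _ (measurableTypeR R) (measurableTypeR R) setT tau.
  by apply: measurable_funD.
pose nu : {measure set (measurableTypeR R) -> \bar R} :=
  pushforward mu tau.
rewrite -[LHS]/(nu mtau A); symmetry.
apply: lebesgue_measure_unique => // X [[a b] _ <-].
rewrite /nu /=.
rewrite /pushforward /=.
have -> : tau @^-1` `]a, b]%classic = `]a - h, b - h]%classic.
  by apply/seteqP; split => x /=; rewrite /tau !in_itv/= ltrBlDr lerBrDr.
rewrite !lebesgue_measure_itv/= !lte_fin ltrD2r; case: ifP => // _.
by rewrite -!EFinB; congr (_%:E); ring.
Qed.
End Translation.

(** * Iterated integrals as integrals over products *)

Section product_sigma_finite.
Local Open Scope ereal_scope.
Context d1 d2 (T1 : measurableType d1) (T2 : measurableType d2) (R : realType).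
Variable m1 : {sigma_finite_measure set T1 -> \bar R}.
Variable m2 : {sigma_finite_measure set T2 -> \bar R}.

Lemma sigma_finite_product_measure : sigma_finite setT (m1 \x m2).
Proof.
have /sigma_finiteP[F [TF ndF Foo]] := sigma_finiteT m1.
have /sigma_finiteP[G [TG ndG Goo]] := sigma_finiteT m2.
exists (fun n => F n `*` G n).
  rewrite -setXTT TF TG predeqE => -[x y]; split.
    move=> [/= [i _ Fx] [j _ Gy]]; exists (maxn i j) => //; split.
    - by move: x Fx; exact/subsetPset/ndF/leq_maxl.
    - by move: y Gy; exact/subsetPset/ndG/leq_maxr.
  by move=> [i _ []/= ? ?]; split; exists i.
move=> i; have [? ?] := Foo i; have [? ?] := Goo i.
split; first exact: measurableX.
by rewrite product_measure1E// lte_mul_pinfty// ge0_fin_numE.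
Qed.

(** Sigma-finiteness lets the product serve again as a factor in the induction on the dimension. *)
Definition sigma_finite_prod : {sigma_finite_measure set (T1 * T2)%type -> \bar R} :=
  HB.pack (m1 \x m2)%E (@Measure_isSigmaFinite.Build _ _ _ (m1 \x m2)%E
  sigma_finite_product_measure).
End product_sigma_finite.

Section Represent.
Variable R : realType.
Local Notation mu := (@lebesgue_measure R).

(** The space underlying the [k]-fold integral has a type depending on [k], so it is kept abstract,
    and [p] reads off the coordinates of a point as a sequence. Nonnegative and integrable functions
    are separated because Fubini controls inner integrals only almost everywhere. The last clause,
    invariance in the [j]-th coordinate, prepares the integration by parts. *)
Definition represents (k : nat) d (T : measurableType d)
    (m : {sigma_finite_measure set T -> \bar R}) (p : T -> seq R) : Prop :=
  [/\ forall i, measurable_fun setT (fun t => nth 0 (p t) i),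
      forall g : seq R -> \bar R, (forall s, 0 <= g s)%E ->
        measurable_fun setT (g \o p) -> iter_int k g = (\int[m]_t (g \o p) t)%E,
      forall g : seq R -> \bar R, m.-integrable setT (g \o p) ->
        iter_int k g = (\int[m]_t (g \o p) t)%E &
      forall j h, (j < k)%N -> exists tau : T -> T,
        [/\ measurable_fun setT tau,
            forall t i, nth 0 (p (tau t)) i = nth 0 (p t) i + (i == j)%:R * h &
            forall A, measurable A -> m (tau @^-1` A) = m A]].

Lemma representable (k : nat) : exists d (T : measurableType d)
  (m : {sigma_finite_measure set T -> \bar R}) (p : T -> seq R), represents k m p.
Proof.
elim: k => [|k [d [T [m [p [mp pos_int int_int trans]]]]]].
  exists _, unit, (dirac tt), (fun _ => [::]); split => //.
  - by move=> g g0 mg /=; rewrite integral_dirac//= diracT mul1e.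
  - by move=> g ig /=; rewrite integral_dirac//= diracT mul1e.
pose m' := sigma_finite_prod mu m.
exists _, (measurableTypeR R * T)%type, m', (fun t => (t.1 : R) :: p t.2); split.
- move=> [|i] /=; first exact: measurable_fst.
  exact: measurableT_comp (mp i) measurable_snd.
- move=> g g0 mg /=; rewrite /m' fubini_tonelli1//=.
  apply: eq_integral => x _; rewrite pos_int//.
  exact: measurableT_comp mg (pair1_measurable _).
- move=> g ig /=; rewrite /m' -integral12_prod_meas1//=.
  (* Sections of an integrable function are integrable off a null set [N]. On [N] the inner iterated
     integral may differ from the inner integral over [m], which does not affect the outer
     integral. *)
  have [N [mN N0 HN]] := ae_integrable1 ig.
  apply: (integral_null_eq mN N0) => x Nx.
  by rewrite int_int//; apply: contrapT => H; apply: Nx; apply: HN.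
- case=> [|j] h jk.
    pose tau0 (x : measurableTypeR R) : measurableTypeR R := x + h.
    have mtau : @measurable_fun _ _ (measurableTypeR R) (measurableTypeR R) setT tau0.
      by apply: measurable_funD.
    exists (fun t => (tau0 t.1, t.2)); split.
    + apply: measurable_fun_pair => //.
      by apply: (measurableT_comp mtau); exact: measurable_fst.
    + by move=> t [|i] /=; rewrite ?mul1r// mul0r addr0.
    + move=> A mA; rewrite /m' /product_measure1.
      pose nu : {measure set (measurableTypeR R) -> \bar R} := pushforward mu tau0.
      (* The section at [x] of the translated set is the section of [A] at [x + h], so the
         translation can be moved to the outer measure. *)
      transitivity (\int[nu mtau]_x (m \o xsection A) x)%E.
        rewrite ge0_integral_pushforward//=; first exact: measurable_fun_xsection.
      apply: eq_measure_integral => B mB _; exact: lebesgue_translation.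
  have [tau [mtau ptau itau]] := trans j h jk.
  exists (fun t => (t.1, tau t.2)); split.
  + by apply: measurable_fun_pair => //; exact: measurableT_comp mtau measurable_snd.
  + by move=> t [|i] /=; rewrite ?mul0r ?addr0.
  + move=> A mA; rewrite /m' /product_measure1; apply: eq_integral => x _ /=.
    rewrite -(itau (xsection A x)); last exact: measurable_xsection.
    by congr (m _); apply/seteqP; split => y /=; rewrite !xsectionE.
Qed.

End Represent.

(** * Borel sets of R^n *)

Section Cubes.
Variables (R : realType) (n : nat).
Implicit Types (x y c : 'rV[R]_n) (r : R) (U : set 'rV[R]_n).

Definition cube c r : set 'rV[R]_n := [set x | forall i, `|x ord0 i - c ord0 i| < r].

Lemma cubeE c r : 0 < r -> cube c r = ball c r.
Proof.
move=> r0; apply/seteqP; split => x /=.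
  by move=> xc; split => // i j; rewrite !ord1 /ball/= distrC; exact: xc.
by move=> [_ xc] i; have := xc ord0 i; rewrite /ball/= distrC.
Qed.

(** Rational centres and radii [1/(N+1)] make the union countable. With [1/(N+1) < e / 2] and a
    centre closer to [x] than the radius, the cube stays in the ball of radius [e] around [x]. *)
Lemma open_cube_cover U : open U ->
  U = \bigcup_(q in [set q : 'rV[rat]_n * nat |
        cube (map_mx ratr q.1) q.2.+1%:R^-1 `<=` U])
        cube (map_mx ratr q.1) q.2.+1%:R^-1.
Proof.
move=> oU; apply/seteqP; split; last by move=> x [q /= qU]; exact: qU.
move=> x Ux.
have /nbhs_ballP [e /= e0 eU] : nbhs x U by apply: open_nbhs_nbhs.
have [N N2e] : exists N : nat, N.+1%:R^-1 < e / 2.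
  have e20 : 0 < e / 2 by rewrite divr_gt0.
  exists (Num.truncn (e / 2)^-1); rewrite invf_plt ?posrE//; exact: truncnS_gt.
have rq i : {q : rat | `|x ord0 i - ratr q| < N.+1%:R^-1}.
  apply: cid.
  have : x ord0 i - N.+1%:R^-1 < x ord0 i + N.+1%:R^-1.
    by rewrite ltrBlDr -addrA ltrDl addr_gt0// invr_gt0.
  move=> /rat_in_itvoo[q]; rewrite in_itv/= => /andP[q1 q2]; exists q.
  move: q1 q2; move: (_^-1) (ratr q) => u v q1 q2.
  by rewrite ltr_norml; apply/andP; split; lra.
have xq : cube (map_mx ratr (\row_i sval (rq i))) N.+1%:R^-1 x.
  by move=> i; rewrite !mxE; exact: (svalP (rq i)).
exists (\row_i sval (rq i), N) => //= y yq.
apply: eU; rewrite -cubeE// => i.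
have := xq i; have := yq i; move: N2e; move: (N.+1%:R^-1) (map_mx _ _ _ _) => u v.
move=> ue; rewrite !ltr_norml => /andP[? ?] /andP[? ?]; apply/andP; split; lra.
Qed.

End Cubes.

Section Borel.
Variables (R : realType) (n : nat).
Implicit Types (x y c : 'rV[R]_n) (r : R) (U : set 'rV[R]_n).

(** Carries the sigma-algebra [borel_Rn], so that measurability on this type is [borel_fun]. *)
Definition Bn := g_sigma_algebraType (@open 'rV[R]_n).

Lemma open_measurable_Bn U : open U -> measurable (U : set Bn).
Proof. by move=> oU; apply: sub_sigma_algebra. Qed.

Lemma continuous_measurable_Bn (f : 'rV[R]_n -> R) :
  continuous f -> measurable_fun setT (f : Bn -> R).
Proof.
move=> /continuousP cf; apply: (measurability _ (RGenOpens.measurableE R)).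
move=> _ [_ [a [b ->] <-]]; rewrite setTI; apply: open_measurable_Bn.
by apply: cf; exact: interval_open.
Qed.

Lemma translation_measurable_Bn (v : 'rV[R]_n) :
  measurable_fun setT ((fun x => x + v) : Bn -> Bn).
Proof.
apply: (@measurability _ _ _ Bn setT _ (@open 'rV[R]_n)) => // _ [U oU <-]; rewrite setTI.
apply: open_measurable_Bn; apply: open_comp => // x _.
by apply: continuousD => //; exact: cst_continuous.
Qed.

(** An open set is a countable union of cubes, and the preimage of a cube is a finite intersection
    of conditions on single coordinates. *)
Lemma measurable_to_Bn d (T : measurableType d) (X : T -> 'rV[R]_n) :
  (forall i, measurable_fun setT (fun t => X t ord0 i)) ->
  measurable_fun setT (X : T -> Bn).
Proof.
move=> mX; apply: (@measurability _ _ _ Bn setT _ (@open 'rV[R]_n)) => // _ [U oU <-]; rewrite setTI.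
rewrite (open_cube_cover oU) preimage_bigcup bigcup_mkcond.
apply: countable_bigcupT_measurable => [|q]; first exact: countableP.
case: ifP => // _.
rewrite (_ : _ @^-1` _ = \bigcap_(i in [set: 'I_n])
   [set t | `|X t ord0 i - (map_mx ratr q.1) ord0 i| < q.2.+1%:R^-1]); last first.
  by apply/seteqP; split => t Ht i; [move=> _; exact: Ht|exact: (Ht i I)].
apply: fin_bigcap_measurable => // i _.
have mf : measurable_fun setT (fun t => `|X t ord0 i - (map_mx ratr q.1) ord0 i|).
  by apply: measurableT_comp => //; apply: measurable_funB.
have := mf measurableT _ (measurable_itv `]-oo, q.2.+1%:R^-1[).
by rewrite setTI; congr (measurable _); apply/seteqP; split => t /=; rewrite in_itv.
Qed.

End Borel.

(** * Lebesgue measure on R^n *)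

Section Box.
Variable R : realType.
Local Notation mu := (@lebesgue_measure R).

Lemma iter_int_box (k : nat) (c : nat -> R) (r : R) : 0 < r ->
  iter_int k (fun s => (\prod_(i < k) \1_(`]c i - r, c i + r[%classic) (nth 0 s i))%:E)
  = ((2 * r) ^+ k)%:E.
Proof.
move=> r0; elim: k c => [|k IH] c /=; first by rewrite big_ord0 expr0.
have len : mu `]c 0%N - r, c 0%N + r[%classic = (2 * r)%:E.
  rewrite lebesgue_measure_itv/= lte_fin; have -> : c 0%N - r < c 0%N + r by lra.
  by rewrite -EFinB; congr (_%:E); ring.
transitivity (\int[mu]_x ((2 * r) ^+ k * \1_(`]c 0%N - r, c 0%N + r[%classic) x)%:E)%E.
  apply: eq_integral => x _.
  transitivity (iter_int k (fun s => ((\1_(`]c 0%N - r, c 0%N + r[%classic) x : R) *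
      \prod_(i < k) \1_(`]c i.+1 - r, c i.+1 + r[%classic) (nth 0 s i))%:E)).
    by congr (iter_int k _); apply/funext => s; rewrite big_ord_recl.
  rewrite [in LHS]indicE [in RHS]indicE; case: (x \in _) => /=.
    rewrite mulr1 -(IH (fun i => c i.+1)).
    by congr (iter_int k _); apply/funext => s; rewrite mul1r.
  rewrite mulr0 (_ : (fun _ => _) = fun=> 0%:E); last by apply/funext => s; rewrite mul0r.
  by elim: {IH} k => //= k ->; rewrite integral0.
under eq_integral do rewrite EFinM.
rewrite integralZl//=; last first.
  apply/integrableP; split; first exact/measurable_EFinP.
  under eq_integral do rewrite gee0_abs ?lee_fin//.
  by rewrite integral_indic// setIT -[ltLHS]/(mu _) len ltry.
rewrite integral_indic// setIT -[X in (_ * X)%E]/(mu _) len.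
by rewrite -EFinM exprS; congr (_%:E); ring.
Qed.
End Box.

Section LebesgueRn.
Variables (R : realType) (n : nat).
Local Notation Bn := (Bn R n).

Definition translate (m : 'I_n) (h : R) (x : 'rV[R]_n) : 'rV[R]_n := x + h *: basis_vec R m.

(** The interface through which Lebesgue measure enters everything below. Translations along the
    axes are enough for integrating partial derivatives by parts. *)
Definition lebesgue_Rn (lam : {measure set Bn -> \bar R}) : Prop :=
  [/\ forall f : Bn -> \bar R, (forall x, 0 <= f x)%E -> measurable_fun setT f ->
        int_Rn (f : 'rV[R]_n -> \bar R) = (\int[lam]_x f x)%E,
      forall f : Bn -> \bar R, lam.-integrable setT f ->
        int_Rn (f : 'rV[R]_n -> \bar R) = (\int[lam]_x f x)%E,
      forall m h (A : set Bn), measurable A -> lam (translate m h @^-1` A) = lam A &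
      forall c r, 0 < r -> lam (cube c r) = ((2 * r) ^+ n)%:E].

(** The image of the product measure under reading coordinates as a row vector. The volume of cubes
    is obtained by going back to the iterated integral of a product of indicators. *)
Lemma lebesgue_Rn_exists : exists lam, lebesgue_Rn lam.
Proof.
have [d [T [m [p [mp pos_int int_int trans]]]]] := representable R n.
pose X (t : T) : Bn := \row_(i < n) nth 0 (p t) i.
have mX : measurable_fun setT X.
  apply: measurable_to_Bn => i.
  by rewrite /X (_ : (fun _ => _) = (fun t => nth 0 (p t) i))//; apply/funext => t; rewrite mxE.
pose lam_ : {measure set Bn -> \bar R} := pushforward m X.
pose lam := lam_ mX.
have posE (f : Bn -> \bar R) : (forall x, 0 <= f x)%E -> measurable_fun setT f ->
    int_Rn (f : 'rV[R]_n -> \bar R) = (\int[lam]_x f x)%E.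
  move=> f0 mf; rewrite /int_Rn pos_int//.
    by rewrite ge0_integral_pushforward.
  exact: (measurableT_comp mf mX).
exists lam; split => //.
- move=> f intf; rewrite /int_Rn.
  have mf : measurable_fun setT f by exact: measurable_int intf.
  have intfX : m.-integrable setT (f \o X).
    apply/integrableP; split; first exact: (measurableT_comp mf mX).
    move/integrableP : intf => [_]; rewrite ge0_integral_pushforward//.
    exact: measurableT_comp.
  by rewrite int_int// integral_pushforward.
- move=> j h A mA; have [tau [mtau ptau itau]] := trans j h (ltn_ord j).
  have mXA : measurable (X @^-1` A) by rewrite -[X in measurable X]setTI; exact: (mX measurableT _ mA).
  transitivity (m (X @^-1` (translate j h @^-1` A))); first by [].
  transitivity (m (X @^-1` A)); last by [].
  rewrite -(itau _ mXA); congr (m _).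
  have sX t : translate j h (X t) = X (tau t).
    by apply/rowP => i; rewrite !mxE ptau eqxx/= mulrC.
  by apply/seteqP; split => t /=; rewrite sX.
- move=> c r r0.
  (* The box lemma takes centres indexed by all integers; the default 0 from [n] on is never
     read. *)
  pose cs i := if insub i is Some o then c ord0 (o : 'I_n) else 0.
  have mcube : measurable (cube c r : set Bn).
    by apply: open_measurable_Bn; rewrite cubeE//; exact: ball_open.
  transitivity (\int[lam]_x (\1_(cube c r) x)%:E)%E.
    by rewrite integral_indic// setIT.
  rewrite -(iter_int_box n cs r0).
  rewrite -(posE (fun x => (\1_(cube c r) x)%:E)) //; last exact/measurable_EFinP.
  rewrite /int_Rn; congr (iter_int n _); apply/funext => s; congr (_%:E).
  rewrite indicE; case: (pselect (cube c r (\row_i s`_i))) => H.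
    rewrite mem_set//= big1// => i _; rewrite indicE mem_set//=.
    have := H i; rewrite mxE /cs valK in_itv/= ltr_norml => /andP[? ?]; apply/andP; split; lra.
  rewrite memNset//=; have [i Hi] : exists i, ~ `|(\row_i s`_i : 'rV[R]_n) ord0 i - c ord0 i| < r.
    by apply: contrapT => /forallNP K; apply: H => i; apply: contrapT; exact: K.
  rewrite (bigD1 i)//= indicE memNset ?mul0r//=.
  rewrite /cs valK in_itv/=; move: Hi; rewrite mxE ltr_norml => Hi /andP[? ?].
  by apply: Hi; apply/andP; split; lra.
Qed.
End LebesgueRn.

(** * A smooth cutoff *)

Section Spline.
Variable R : realType.
Implicit Types t s z : R.

Definition ramp z := (z + `|z|) / 2.

Lemma ramp_ge0 z : 0 <= z -> ramp z = z.
Proof. by move=> z0; rewrite /ramp ger0_norm//; lra. Qed.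

Lemma ramp_le0 z : z <= 0 -> ramp z = 0.
Proof. by move=> z0; rewrite /ramp ler0_norm//; lra. Qed.

Lemma ramp_continuous : continuous ramp.
Proof.
move=> z; apply: cvgMl; apply: cvgD; first exact: cvg_id.
exact: norm_continuous.
Qed.

(** The square of [ramp] has derivative [2 * ramp], which is 2-Lipschitz; hence the remainder,
    checked on the signs of [z] and [z + s]. *)
Lemma ramp_sqr_taylor z s : `|ramp (z + s) ^+ 2 - ramp z ^+ 2 - s * (2 * ramp z)| <= s ^+ 2.
Proof.
rewrite ler_norml; case: (lerP 0 z) => z0; case: (lerP 0 (z + s)) => zs0.
- by rewrite !ramp_ge0//; apply/andP; split; nra.
- by rewrite (ramp_le0 (ltW zs0)) ramp_ge0//; apply/andP; split; nra.
- by rewrite (ramp_le0 (ltW z0)) ramp_ge0//; apply/andP; split; nra.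
- by rewrite (ramp_le0 (ltW z0)) (ramp_le0 (ltW zs0)); apply/andP; split; nra.
Qed.

(* The integral of a piecewise linear function with nodes at +-1, +-3/4, +-1/2;
   it equals 1 on [-1/2, 1/2] and vanishes off [-1, 1]. *)
Definition spline t := 8 * (ramp (t + 1) ^+ 2 - 2 * ramp (t + 3/4) ^+ 2 + ramp (t + 1/2) ^+ 2
  - ramp (t - 1/2) ^+ 2 + 2 * ramp (t - 3/4) ^+ 2 - ramp (t - 1) ^+ 2).

(** A hat of height 4 on [[-1, -1/2]] with peak at [-3/4], and its mirror image with opposite sign.
    The hat has area 1, so its integral rises to exactly 1. *)
Definition dspline t := 16 * (ramp (t + 1) - 2 * ramp (t + 3/4) + ramp (t + 1/2)
  - ramp (t - 1/2) + 2 * ramp (t - 3/4) - ramp (t - 1)).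

(** The constant adds up the absolute coefficients: [8 * (1 + 2 + 1 + 1 + 2 + 1) = 64]. *)
Lemma spline_taylor t s : `|spline (t + s) - spline t - s * dspline t| <= 64 * s ^+ 2.
Proof.
have T a := ramp_sqr_taylor (t + a) s.
have := T 1; have := T (3/4); have := T (1/2).
have := T (- (1/2)); have := T (- (3/4)); have := T (-1).
rewrite /spline /dspline !(addrAC t s) !ler_norml.
move=> /andP[? ?] /andP[? ?] /andP[? ?] /andP[? ?] /andP[? ?] /andP[? ?].
by apply/andP; split; lra.
Qed.

Lemma spline_cases t : [\/ [/\ 1 <= `|t|, spline t = 0 & dspline t = 0],
  [/\ `|t| <= 1 / 2, spline t = 1 & dspline t = 0] |
  [/\ 1 / 2 < `|t| < 1, 0 <= spline t <= 1 & `|dspline t| <= 4]].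
Proof.
have ge a : 0 <= t + a -> ramp (t + a) = t + a by exact: ramp_ge0.
have le a : t + a <= 0 -> ramp (t + a) = 0 by exact: ramp_le0.
rewrite /spline /dspline.
have [t0|t0] := lerP 0 t.
  rewrite ger0_norm// (ge 1) ?(ge (3/4)) ?(ge (1/2)); try lra.
  have [h1|h1] := lerP t (1/2).
    by apply: Or32; rewrite !le; try lra; split => //; lra.
  have [h2|h2] := lerP t (3/4).
    apply: Or33; rewrite (ge (- (1/2))) ?(le (- (3/4))) ?(le (-1)); try lra.
    split; [by apply/andP; split; lra|by apply/andP; split; nra|].
    by rewrite ler_norml; apply/andP; split; lra.
  have [h3|h3] := lerP 1 t.
    by apply: Or31; rewrite !ge; try lra; split => //; lra.
  apply: Or33; rewrite (ge (- (1/2))) ?(ge (- (3/4))) ?(le (-1)); try lra.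
  split; [by apply/andP; split; lra|by apply/andP; split; nra|].
  by rewrite ler_norml; apply/andP; split; lra.
rewrite ltr0_norm// (le (-1)) ?(le (-(3/4))) ?(le (-(1/2))); try lra.
have [h1|h1] := lerP (-t) (1/2).
  by apply: Or32; rewrite !ge; try lra; split => //; lra.
have [h2|h2] := lerP (-t) (3/4).
  apply: Or33; rewrite (le (1/2)) ?(ge (3/4)) ?(ge 1); try lra.
  split; [by apply/andP; split; lra|by apply/andP; split; nra|].
  by rewrite ler_norml; apply/andP; split; lra.
have [h3|h3] := lerP 1 (-t).
  by apply: Or31; rewrite !le; try lra; split => //; lra.
apply: Or33; rewrite (le (1/2)) ?(le (3/4)) ?(ge 1); try lra.
split; [by apply/andP; split; lra|by apply/andP; split; nra|].
by rewrite ler_norml; apply/andP; split; lra.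
Qed.

Lemma spline_ge0_le1 t : 0 <= spline t <= 1.
Proof. by case: (spline_cases t) => -[_ -> //]; rewrite ?lexx ?ler01. Qed.

Lemma dspline_bound t : `|dspline t| <= 4.
Proof. by case: (spline_cases t) => -[_ _ //] ->; rewrite normr0; lra. Qed.

Lemma spline_continuous : continuous spline.
Proof.
have c a : continuous (fun t => ramp (t + a) ^+ 2).
  move=> t; apply: (@continuous_comp _ _ _ (fun t => ramp (t + a)) (fun z => z ^+ 2)).
    apply: (@continuous_comp _ _ _ (fun t => t + a) ramp); last exact: ramp_continuous.
    by apply: cvgD; [exact: cvg_id|exact: cvg_cst].
  exact: exprn_continuous.
move=> t; apply: cvgMr; apply: cvgB; last exact: c.
apply: cvgD; last by apply: cvgMr; exact: c.
apply: cvgB; last exact: c.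
apply: cvgD; last exact: c.
apply: cvgB; first exact: c.
by apply: cvgMr; exact: c.
Qed.

Lemma dspline_continuous : continuous dspline.
Proof.
have c a : continuous (fun t => ramp (t + a)).
  move=> t; apply: (@continuous_comp _ _ _ (fun t => t + a) ramp); last exact: ramp_continuous.
  by apply: cvgD; [exact: cvg_id|exact: cvg_cst].
move=> t; apply: cvgMr; apply: cvgB; last exact: c.
apply: cvgD; last by apply: cvgMr; exact: c.
apply: cvgB; last exact: c.
apply: cvgD; last exact: c.
apply: cvgB; first exact: c.
by apply: cvgMr; exact: c.
Qed.

End Spline.

Section Translate.
Variables (R : realType) (n : nat).
Implicit Types (x c : 'rV[R]_n) (m i : 'I_n) (psi : 'rV[R]_n -> R).

Lemma translateE m h x i : translate m h x ord0 i = x ord0 i + (i == m)%:R * h.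
Proof. by rewrite !mxE eqxx/= mulrC. Qed.

Lemma translateD m s h x : translate m (h + s) x = translate m h (translate m s x).
Proof. by rewrite /translate scalerDl addrA [in RHS]addrAC. Qed.

Lemma translate0 m x : translate m 0 x = x.
Proof. by rewrite /translate scale0r addr0. Qed.

Lemma translate_continuous m x : continuous (fun h : R => translate m h x).
Proof. by move=> h; apply: cvgD; [exact: cvg_cst|exact: scalel_continuous]. Qed.

Lemma inv_succ_cvg0' : (fun p : nat => p.+1%:R^-1 : R) @ \oo --> (0 : R)^'.
Proof.
move=> A [e /= e0 eA]; have [N _ HN] := @cvg_harmonic R _ (nbhsx_ballx (0 : R) e e0).
by exists N => // p /= /HN pe; apply: eA => //; rewrite invr_eq0.
Qed.

(** Derivatives are limits along a punctured neighbourhood filter; dominated convergence asks for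
    sequences, here with steps [1/(p+1)]. *)
Lemma translate_quotient_cvg psi m x : derivable psi x (basis_vec R m) ->
  (fun p : nat => (psi (translate m p.+1%:R^-1 x) - psi x) * p.+1%:R) @ \oo -->
  'D_(basis_vec R m) psi x.
Proof.
move=> dpsi; have := cvg_comp _ _ inv_succ_cvg0' dpsi; apply: cvg_trans.
apply: near_eq_cvg; near=> p => /=.
by rewrite /translate invrK [_ *: _ + x]addrC [in RHS]mulrC.
Unshelve. all: by end_near. Qed.

Lemma translate_is_derive psi m x s : derivable psi (translate m s x) (basis_vec R m) ->
  is_derive s (1 : R) (fun h => psi (translate m h x))
    ('D_(basis_vec R m) psi (translate m s x)).
Proof.
move=> dpsi.
have E : (fun h : R => h^-1 *: (((fun h => psi (translate m h x)) \o shift s) (h *: (1 : R))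
            - psi (translate m s x))) =
    (fun h : R => h^-1 *: ((psi \o shift (translate m s x)) (h *: basis_vec R m)
            - psi (translate m s x))).
  apply/funext => h /=; rewrite [h%:A]mulr1 translateD.
  by congr (_ *: (psi _ - _)); rewrite [LHS]/translate addrC.
by split; rewrite /derivable /derive E.
Qed.

Lemma translate_lipschitz psi m x t K : 0 < t ->
  (forall y, derivable psi y (basis_vec R m)) ->
  (forall s, 0 <= s <= t -> `|'D_(basis_vec R m) psi (translate m s x)| <= K) ->
  `|psi (translate m t x) - psi x| <= K * t.
Proof.
move=> t0 dpsi DK.
have der s : is_derive s (1 : R) (fun h => psi (translate m h x))
    ('D_(basis_vec R m) psi (translate m s x)) by exact: translate_is_derive.
have [|s sin] := MVT t0 (fun s _ => der s).
  by apply: derivable_within_continuous => s _; apply: ex_derive.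
rewrite translate0 subr0 => ->; rewrite normrM (gtr0_norm t0) ler_pM2r//.
by apply: DK; move: sin; rewrite in_itv/= => /andP[? ?]; rewrite !ltW.
Qed.

End Translate.

Section Bump.
Variables (R : realType) (n : nat).
Implicit Types (x c : 'rV[R]_n) (r : R) (m i : 'I_n).

Definition bump c r x : R := \prod_i spline ((x ord0 i - c ord0 i) / r).

(** The partial derivative of [bump] along [m]. The link between the two is the expansion
    [bump_translate]; no differential of [bump] is formed. *)
Definition dbump m c r x : R := r^-1 * dspline ((x ord0 m - c ord0 m) / r) *
  \prod_(i | i != m) spline ((x ord0 i - c ord0 i) / r).

Lemma prod_spline_ge0_le1 (P : pred 'I_n) (f : 'I_n -> R) :
  0 <= \prod_(i | P i) spline (f i) <= 1.
Proof.
apply/andP; split; first by apply: prodr_ge0 => i _; case/andP: (spline_ge0_le1 (f i)).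
by apply: prodr_ile1 => i _; exact: spline_ge0_le1.
Qed.

Lemma bump_ge0 c r x : 0 <= bump c r x.
Proof. by case/andP: (prod_spline_ge0_le1 xpredT (fun i => (x ord0 i - c ord0 i) / r)). Qed.

Lemma bump_le1 c r x : bump c r x <= 1.
Proof. by case/andP: (prod_spline_ge0_le1 xpredT (fun i => (x ord0 i - c ord0 i) / r)). Qed.

Lemma spline_eq0_out t : 1 <= `|t| -> spline t = 0 /\ dspline t = 0 :> R.
Proof. by move=> t1; case: (spline_cases t) => -[h]; [| lra|case/andP: h; lra]. Qed.

Lemma bump_eq0 c r x : 0 < r -> ~ cube c r x -> bump c r x = 0.
Proof.
move=> r0 /existsNP [i /negP]; rewrite -leNgt => H; rewrite /bump (bigD1 i)//=.
have [-> _] : spline ((x ord0 i - c ord0 i) / r) = 0 /\ dspline ((x ord0 i - c ord0 i) / r) = 0 :> R.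
  by apply: spline_eq0_out; rewrite normrM normfV (gtr0_norm r0) ler_pdivlMr// mul1r.
by rewrite mul0r.
Qed.

Lemma dbump_eq0 m c r x : 0 < r -> ~ cube c r x -> dbump m c r x = 0.
Proof.
move=> r0 /existsNP [i /negP]; rewrite -leNgt => H.
have [h0 dh0] : spline ((x ord0 i - c ord0 i) / r) = 0 /\ dspline ((x ord0 i - c ord0 i) / r) = 0 :> R.
  by apply: spline_eq0_out; rewrite normrM normfV (gtr0_norm r0) ler_pdivlMr// mul1r.
rewrite /dbump; have [im|im] := eqVneq i m; first by rewrite -im dh0 mulr0 mul0r.
by rewrite (bigD1 i)//= h0 mul0r mulr0.
Qed.

Lemma bump_eq1 c r x : 0 < r -> (forall i, `|x ord0 i - c ord0 i| <= r / 2) -> bump c r x = 1.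
Proof.
move=> r0 H; rewrite /bump big1// => i _.
case: (spline_cases ((x ord0 i - c ord0 i) / r)) => -[h]//;
  move: h; rewrite normrM normfV (gtr0_norm r0).
- by rewrite ler_pdivlMr// => ?; have := H i; lra.
- by rewrite ltr_pdivlMr// => /andP[? _]; have := H i; lra.
Qed.

Lemma dbump_eq0_in m c r x : 0 < r -> `|x ord0 m - c ord0 m| <= r / 2 -> dbump m c r x = 0.
Proof.
move=> r0 H; rewrite /dbump.
case: (spline_cases ((x ord0 m - c ord0 m) / r)) => -[h].
- by move=> _ ->; rewrite mulr0 mul0r.
- by move=> _ ->; rewrite mulr0 mul0r.
by move: h; rewrite normrM normfV (gtr0_norm r0) ltr_pdivlMr// => /andP[? _]; lra.
Qed.

Lemma dbump_bound m c r x : 0 < r -> `|dbump m c r x| <= 4 / r.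
Proof.
move=> r0; rewrite /dbump normrM [X in X * _]normrM (gtr0_norm (x := r^-1)) ?invr_gt0//.
have r1 : 0 < r^-1 by rewrite invr_gt0.
rewrite -[leRHS]mulr1 [4 / r]mulrC; apply: ler_pM => //.
- by rewrite mulr_ge0// ltW.
- by apply: ler_pM => //; [exact: ltW|exact: dspline_bound].
- by rewrite ger0_norm; case/andP: (prod_spline_ge0_le1 (fun i => i != m) (fun i => (x ord0 i - c ord0 i) / r)).
Qed.

Lemma coord_scaled_continuous c r i : continuous (fun x : 'rV[R]_n => (x ord0 i - c ord0 i) / r).
Proof.
move=> x; have FF := nbhs_filter x.
have cB := cvgB (@coord_continuous R 1 n ord0 i x) (cvg_cst (c ord0 i)).
exact: (cvgM (cB FF FF) (cvg_cst r^-1)).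
Qed.

Lemma bump_continuous c r : continuous (bump c r).
Proof.
apply: (@continuous_big R _ *%R 1 xpredT (@mul_continuous R) _ _
  (fun i (x : 'rV[R]_n) => spline ((x ord0 i - c ord0 i) / r))) => i _ x.
apply: (@continuous_comp _ _ _ (fun x => (x ord0 i - c ord0 i) / r) (@spline R)).
  exact: coord_scaled_continuous.
exact: spline_continuous.
Qed.

Lemma dbump_continuous m c r : continuous (dbump m c r).
Proof.
move=> x; have FF := nbhs_filter x; apply: cvgM.
  apply: (@cvgM _ _ (nbhs x) FF); first exact: cvg_cst.
  apply: (@continuous_comp _ _ _ (fun x => (x ord0 m - c ord0 m) / r) (@dspline R)).
    exact: coord_scaled_continuous.
  exact: dspline_continuous.
move: {FF} x; apply: (@continuous_big R _ *%R 1 (fun i => i != m) (@mul_continuous R) _ _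
  (fun i (x : 'rV[R]_n) => spline ((x ord0 i - c ord0 i) / r))) => i _ x.
apply: (@continuous_comp _ _ _ (fun x => (x ord0 i - c ord0 i) / r) (@spline R)).
  exact: coord_scaled_continuous.
exact: spline_continuous.
Qed.

(** A translation along [m] changes one factor of the product; the others lie in [[0, 1]], so the
    Taylor bound of [spline], rescaled by [r], survives. *)
Lemma bump_translate m c r x t : 0 < r ->
  `|bump c r (translate m t x) - bump c r x - t * dbump m c r x| <= 64 / r ^+ 2 * t ^+ 2.
Proof.
move=> r0; rewrite /bump (bigD1 m)//= [X in _ - X - _](bigD1 m)//= /dbump.
set P := \prod_(i | i != m) _; set Q := \prod_(i | i != m) _.
have -> : P = Q.
  by apply: eq_bigr => i im; rewrite translateE (negbTE im) mul0r addr0.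
rewrite translateE eqxx mul1r.
set z := x ord0 m - c ord0 m.
have -> : (x ord0 m + t - c ord0 m) / r = z / r + t / r by rewrite /z -mulrDl addrAC.
have -> : spline (z / r + t / r) * Q - spline (z / r) * Q - t * (r^-1 * dspline (z / r) * Q)
  = (spline (z / r + t / r) - spline (z / r) - t / r * dspline (z / r)) * Q by ring.
have /andP[Q0 Q1] : 0 <= Q <= 1 by exact: prod_spline_ge0_le1.
have := spline_taylor (z / r) (t / r); rewrite exprMn exprVn.
have -> : 64 / r ^+ 2 * t ^+ 2 = 64 * (t ^+ 2 / r ^+ 2) by ring.
move=> T; rewrite normrM (ger0_norm Q0) -[leRHS]mulr1.
by apply: ler_pM.
Qed.

End Bump.

(** * Integration by parts *)

Section Parts.
Variables (R : realType) (n : nat).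
Local Notation Bn := (Bn R n).
Variable lam : {measure set Bn -> \bar R}.
Hypothesis Hlam : lebesgue_Rn lam.
Implicit Types (x c : 'rV[R]_n) (m i : 'I_n) (r : R).

Lemma measurable_cube c r : measurable (cube c r : set Bn).
Proof.
have [r0|r0] := ltrP 0 r.
  by apply: open_measurable_Bn; rewrite cubeE//; exact: ball_open.
have [n0|n0] := posnP n.
  rewrite (_ : cube c r = setT)//; apply/seteqP; split => // x _ i.
  by have := leq_ltn_trans (leq0n i) (ltn_ord i); lia.
rewrite (_ : cube c r = set0)//; apply/seteqP; split => // x /(_ (Ordinal n0)) h.
by have := le_lt_trans (normr_ge0 _) h; rewrite ltNge r0.
Qed.

Lemma continuous_bounded_cube (psi : 'rV[R]_n -> R) c r : continuous psi ->
  exists2 K, 0 <= K & forall x, cube c r x -> `|psi x| <= K.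
Proof.
move=> cpsi.
pose A := [set x : 'rV[R]_n | forall i, x ord0 i \in `[c ord0 i - r, c ord0 i + r]].
have cA : compact A.
  apply: (@rV_compact _ _ (fun i => `[c ord0 i - r, c ord0 i + r]%classic)) => i.
  exact: segment_compact.
have /compact_bounded [M [Mr HM]] : compact (psi @` A).
  by apply: continuous_compact => //; exact: continuous_subspaceT.
exists (`|M| + 1); first by rewrite addr_ge0.
move=> x xc; apply: (HM (`|M| + 1)); first by rewrite (le_lt_trans (ler_norm _))// ltrDl.
exists x => // i; have := xc i; rewrite ltr_norml in_itv/= => /andP[? ?].
by apply/andP; split; lra.
Qed.

Lemma integrable_cube (f : Bn -> R) c r K : measurable_fun setT f -> 0 < r ->
  (forall x, `|f x| <= K) -> (forall x, ~ cube c r x -> f x = 0) ->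
  lam.-integrable setT (EFin \o f).
Proof.
move=> mf r0 fK f0; have [_ _ _ Hc] := Hlam.
have ic : lam.-integrable setT (fun x => (K * \1_(cube c r) x)%:E).
  rewrite (_ : (fun _ => _) = (fun x => K%:E * (\1_(cube c r) x)%:E)%E); last first.
    by apply/funext => x; rewrite EFinM.
  apply: integrableZl => //.
  apply/integrableP; split; first by apply/measurable_EFinP; apply: measurable_indic; exact: measurable_cube.
  under eq_integral do rewrite gee0_abs ?lee_fin//.
  rewrite integral_indic//; last exact: measurable_cube.
  by rewrite setIT [ltLHS](Hc c r r0) ltry.
apply: (le_integrable measurableT _ _ ic); first exact/measurable_EFinP.
move=> x _ /=; rewrite lee_fin indicE; have [xc|xc] := pselect (cube c r x).
  by rewrite mem_set// mulr1 (le_trans (fK x))// ler_norm.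
by rewrite f0// normr0.
Qed.

Lemma integral_translate m h (f : Bn -> R) : lam.-integrable setT (EFin \o f) ->
  lam.-integrable setT (fun x => (f (translate m h x))%:E) /\
  (\int[lam]_x (f (translate m h x))%:E = \int[lam]_x (f x)%:E)%E.
Proof.
move=> intf; have [_ _ Htr _] := Hlam.
have mtau : measurable_fun setT (translate m h : Bn -> Bn).
  exact: translation_measurable_Bn.
have mf := measurable_int _ intf.
pose nu_ : {measure set Bn -> \bar R} := pushforward lam (translate m h : Bn -> Bn).
pose nu := nu_ mtau.
have nuE (g : Bn -> \bar R) : (\int[nu]_x g x = \int[lam]_x g x)%E.
  by apply: eq_measure_integral => A mA _; exact: Htr.
have intft : lam.-integrable setT (fun x => (f (translate m h x))%:E).
  apply/integrableP; split; first exact: (measurableT_comp mf mtau).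
  move/integrableP : (intf) => [_]; rewrite -(nuE (fun x => `|(EFin \o f) x|)%E).
  rewrite ge0_integral_pushforward//; exact: measurableT_comp.
split => //; rewrite -[RHS](nuE (EFin \o f)) [RHS]integral_pushforward//.
Qed.

(** Every difference quotient integrates to zero by translation invariance; the Lipschitz bound
    dominates the quotients, so the zero passes to the limit. *)
Lemma integral_derivative0 m (f f' : Bn -> R) c r C K : 0 < r ->
  measurable_fun setT f -> (forall x, `|f x| <= K) ->
  (forall x, ~ cube c r x -> f x = 0) ->
  (forall x t, 0 < t <= 1 -> `|f (translate m t x) - f x| <= C * t) ->
  (forall x, (fun p : nat => (f (translate m p.+1%:R^-1 x) - f x) * p.+1%:R) @ \oo --> f' x) ->
  lam.-integrable setT (EFin \o f') /\ (\int[lam]_x (f' x)%:E = 0)%E.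
Proof.
move=> r0 mf fK f0 fC f'E.
have intf := integrable_cube mf r0 fK f0.
pose F (p : nat) (x : Bn) : R := (f (translate m p.+1%:R^-1 x) - f x) * p.+1%:R.
have mt h : measurable_fun setT (fun x : Bn => f (translate m h x)).
  apply: (measurableT_comp mf); exact: translation_measurable_Bn.
have mF p : measurable_fun setT (F p).
  by apply: measurable_funM => //; apply: measurable_funB.
(* Steps are at most 1, so all quotients vanish off the cube enlarged by 1. *)
have FC p x : `|F p x| <= C * \1_(cube c (r + 1)) x.
  have p0 : (0 : R) < p.+1%:R by [].
  have p1 : 0 < (p.+1%:R^-1 : R) <= 1 by rewrite invr_gt0 p0/= invf_le1// ler1n.
  rewrite indicE; have [xc|xc] := pselect (cube c (r + 1) x).
    rewrite mem_set// mulr1 normrM (gtr0_norm p0) -ler_pdivlMr//; exact: fC.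
  rewrite memNset// mulr0 /F !f0 ?subrr ?mul0r ?normr0// => H; apply: xc => i.
    by have := H i; lra.
  have := H i; rewrite translateE; case/andP: p1; move: (_^-1) => t t0 t1.
  rewrite !ltr_norml; case: (i == m) => /= /andP[? ?]; apply/andP; split; lra.
have mf' : measurable_fun setT f' by apply: (measurable_fun_cvg mF) => x _; exact: f'E.
have ic : lam.-integrable setT (fun x => (C * \1_(cube c (r + 1)) x)%:E).
  apply: (@integrable_cube (fun x => C * \1_(cube c (r + 1)) x) c (r + 1) `|C|).
  - by apply: measurable_funM => //; apply: measurable_indic; exact: measurable_cube.
  - by rewrite addr_gt0.
  - by move=> x; rewrite normrM ler_piMr// indicE; case: (_ \in _); rewrite ?normr1 ?normr0.
  - by move=> x xc; rewrite indicE memNset// mulr0.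
have [] := @dominated_convergence _ _ _ lam setT measurableT (fun p => EFin \o F p)
  (EFin \o f') (fun x => (C * \1_(cube c (r + 1)) x)%:E).
- by move=> p; exact/measurable_EFinP.
- exact/measurable_EFinP.
- by apply: aeW => x _; apply: cvg_EFin; [near=> p|exact: f'E].
- exact: ic.
- by apply: aeW => x p _ /=; rewrite lee_fin.
move=> if' _ lim; split => //.
apply: (@cvg_unique _ (@ereal_hausdorff R) _ _ _ _ lim).
rewrite (_ : (fun _ => _) = fun=> 0%E); first exact: cvg_cst.
apply/funext => p /=.
have [it eqt] := integral_translate m p.+1%:R^-1 intf.
under eq_integral do rewrite /F EFinM EFinB.
rewrite integralZr//; last exact: integrableB.
rewrite integralB//= eqt subee ?mul0e//.
exact: integrable_fin_num.
Unshelve. all: by end_near. Qed.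

End Parts.

Section IntegrationByParts.
Variables (R : realType) (n : nat).
Local Notation Bn := (Bn R n).
Variable lam : {measure set Bn -> \bar R}.
Hypothesis Hlam : lebesgue_Rn lam.
Implicit Types (x c : 'rV[R]_n) (m i : 'I_n) (r : R) (psi : 'rV[R]_n -> R) (f g : Bn -> R).

Definition C1_along m psi := [/\ forall x, derivable psi x (basis_vec R m),
  continuous psi & continuous ('D_(basis_vec R m) psi)].

(* g is the weak m-th partial derivative of f, for test functions without
   support condition: f and g will have compact support. *)
Definition ibp m f g := forall psi, C1_along m psi ->
  [/\ lam.-integrable setT (fun x => (f x * 'D_(basis_vec R m) psi x)%:E),
      lam.-integrable setT (fun x => (g x * psi x)%:E) &
      (\int[lam]_x (f x * 'D_(basis_vec R m) psi x)%:E
         = - \int[lam]_x (g x * psi x)%:E)%E].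

Lemma ibp0 m : ibp m (fun=> 0) (fun=> 0).
Proof.
move=> psi _.
have E h : (fun x : Bn => (0 * h x)%:E) = cst (0%E : \bar R).
  by apply/funext => x; rewrite mul0r.
split; [by rewrite E; exact: integrable0|by rewrite E; exact: integrable0|].
by rewrite !E integral0 oppe0.
Qed.

Lemma ibpD m f1 g1 f2 g2 : ibp m f1 g1 -> ibp m f2 g2 ->
  ibp m (fun x => f1 x + f2 x) (fun x => g1 x + g2 x).
Proof.
move=> H1 H2 psi Cpsi; have [i1 j1 e1] := H1 psi Cpsi; have [i2 j2 e2] := H2 psi Cpsi.
have E (u v w : Bn -> R) : (fun x : Bn => ((u x + v x) * w x)%:E) =
    ((fun x : Bn => (u x * w x)%:E) \+ (fun x : Bn => (v x * w x)%:E))%E.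
  by apply/funext => x; rewrite mulrDl EFinD.
split; [by rewrite E; exact: integrableD|by rewrite E; exact: integrableD|].
rewrite !E !integralD// e1 e2 fin_num_oppeD//.
exact: integrable_fin_num.
Qed.

Lemma ibpZ m a f g : ibp m f g -> ibp m (fun x => a * f x) (fun x => a * g x).
Proof.
move=> H psi Cpsi; have [i1 j1 e1] := H psi Cpsi.
have E (u w : Bn -> R) : (fun x : Bn => ((a * u x) * w x)%:E) =
    (fun x : Bn => a%:E * (u x * w x)%:E)%E.
  by apply/funext => x; rewrite -mulrA EFinM.
split; [by rewrite E; exact: integrableZl|by rewrite E; exact: integrableZl|].
by rewrite !E !integralZl// e1 muleN.
Qed.

Lemma ibp_sum m (I : Type) (s : seq I) (P : pred I) (f g : I -> Bn -> R) :
  (forall j, P j -> ibp m (f j) (g j)) ->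
  ibp m (fun x => \sum_(j <- s | P j) f j x) (fun x => \sum_(j <- s | P j) g j x).
Proof.
move=> H; elim: s => [|a s IH].
  have E (h : I -> Bn -> R) : (fun x => \sum_(j <- [::] | P j) h j x) = fun=> 0.
    by apply/funext => x; rewrite big_nil.
  by rewrite !E; exact: ibp0.
have [Pa|Pa] := boolP (P a).
  have E (h : I -> Bn -> R) : (fun x => \sum_(j <- a :: s | P j) h j x) =
      fun x => h a x + \sum_(j <- s | P j) h j x.
    by apply/funext => x; rewrite big_cons Pa.
  by rewrite !E; apply: ibpD => //; exact: H.
have E (h : I -> Bn -> R) : (fun x => \sum_(j <- a :: s | P j) h j x) =
    fun x => \sum_(j <- s | P j) h j x.
  by apply/funext => x; rewrite big_cons (negbTE Pa).
by rewrite !E.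
Qed.

Lemma cubeS c r s x : r <= s -> cube c r x -> cube c s x.
Proof. by move=> rs xc i; exact: lt_le_trans (xc i) rs. Qed.

Lemma cube_translate c r m t x : `|t| <= 1 -> cube c r x -> cube c (r + 1) (translate m t x).
Proof.
move=> t1 xc i; rewrite translateE addrAC; apply: (le_lt_trans (ler_normD _ _)).
apply: ltr_leD => //; rewrite normrM; case: (i == m); rewrite ?normr1 ?mul1r//.
by rewrite normr0 mul0r.
Qed.

(** The product of the bump and [psi] has compact support, so its derivative integrates to zero; the
    product rule splits that derivative into the two sides. *)
Lemma ibp_bump m c r : 0 < r -> ibp m (bump c r : Bn -> R) (dbump m c r).
Proof.
move=> r0 psi [dpsi cpsi cD].
have [K1 K10 HK1] := @continuous_bounded_cube R n psi c (r + 1) cpsi.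
have [K2 K20 HK2] := @continuous_bounded_cube R n _ c (r + 1) cD.
have mb := continuous_measurable_Bn (@bump_continuous R n c r).
have mdb := continuous_measurable_Bn (@dbump_continuous R n m c r).
have mpsi := continuous_measurable_Bn cpsi.
have mD := continuous_measurable_Bn cD.
have b1 x : `|bump c r x| <= 1 by rewrite ger0_norm ?bump_ge0// bump_le1.
have rr1 : r <= r + 1 by rewrite lerDl.
have i1 : lam.-integrable setT (EFin \o (fun x => bump c r x * 'D_(basis_vec R m) psi x)).
  apply: (integrable_cube Hlam (c := c) (r := r) (K := K2)) => //.
  - exact: measurable_funM.
  - move=> x; have [xc|xc] := pselect (cube c r x); last by rewrite bump_eq0// mul0r normr0.
    by rewrite normrM -[leRHS]mul1r ler_pM// HK2//; exact: cubeS xc.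
  - by move=> x xc; rewrite bump_eq0// mul0r.
have i2 : lam.-integrable setT (EFin \o (fun x => dbump m c r x * psi x)).
  apply: (integrable_cube Hlam (c := c) (r := r) (K := 4 / r * K1)) => //.
  - exact: measurable_funM.
  - move=> x; have [xc|xc] := pselect (cube c r x); last first.
      by rewrite dbump_eq0// mul0r normr0 mulr_ge0// divr_ge0// ltW.
    by rewrite normrM ler_pM// ?dbump_bound// HK1//; exact: cubeS xc.
  - by move=> x xc; rewrite dbump_eq0// mul0r.
split => //.
pose f (x : Bn) := bump c r x * psi x.
pose f' (x : Bn) := dbump m c r x * psi x + bump c r x * 'D_(basis_vec R m) psi x.
have [_ f'0] : lam.-integrable setT (EFin \o f') /\ (\int[lam]_x (f' x)%:E = 0)%E.
  (* In [C], the term [4 / r + 64 / r ^+ 2] is a Lipschitz constant of the bump for steps at most 1,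
     while [K1] and [K2] bound [psi] and its derivative on the enlarged cube. *)
  apply: (integral_derivative0 Hlam (m := m) (f := f) (c := c) (r := r)
    (C := (4 / r + 64 / r ^+ 2) * K1 + K2) (K := K1)) => //.
  - exact: measurable_funM.
  - move=> x; rewrite /f; have [xc|xc] := pselect (cube c r x); last by rewrite bump_eq0// mul0r normr0.
    by rewrite normrM -[leRHS]mul1r ler_pM// HK1//; exact: cubeS xc.
  - by move=> x xc; rewrite /f bump_eq0// mul0r.
  - move=> x t /andP[t0 t1]; rewrite /f.
    set y := translate m t x.
    have -> : bump c r y * psi y - bump c r x * psi x =
      (bump c r y - bump c r x) * psi y + bump c r x * (psi y - psi x) by ring.
    rewrite [leRHS]mulrDl; apply: (le_trans (ler_normD _ _)); apply: lerD.
      have [yc|yc] := pselect (cube c (r + 1) y); last first.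
        rewrite !bump_eq0// ?subrr ?mul0r ?normr0.
        + by rewrite mulr_ge0 ?(ltW t0)// mulr_ge0// (le_trans (normr_ge0 (dbump m c r x)))// (le_trans (dbump_bound _ _ _ r0))// lerDl divr_ge0// exprn_ge0// ltW.
        + by move=> xc; apply: yc; apply: cube_translate xc; rewrite ger0_norm// ltW.
        + by move=> yc'; apply: yc; exact: cubeS yc'.
      rewrite normrM mulrAC; apply: ler_pM => //; last exact: HK1.
      have := bump_translate m c x t r0; have := dbump_bound m c x r0; rewrite -/y.
      set a := dbump _ _ _ _; set b := bump c r y - bump c r x => ha hb.
      have -> : b = (b - t * a) + t * a by ring.
      apply: (le_trans (ler_normD _ _)); rewrite addrC mulrDl; apply: lerD.
        by rewrite normrM (gtr0_norm t0) mulrC ler_pM2r.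
      apply: (le_trans hb); rewrite ler_pM2l; last by rewrite divr_gt0// exprn_gt0.
      by rewrite expr2 ler_piMr// ltW.
    have [xc|xc] := pselect (cube c r x); last first.
      by rewrite bump_eq0// mul0r normr0 mulr_ge0// (ltW t0).
    rewrite normrM -[leRHS]mul1r ler_pM//.
    apply: translate_lipschitz => // s /andP[s0 st]; apply: HK2.
    by apply: cube_translate xc; rewrite ger0_norm// (le_trans st).
  - move=> x; pose t (p : nat) : R := p.+1%:R^-1.
    rewrite (_ : (fun p : nat => _) = (fun p => (bump c r (translate m (t p) x) - bump c r x) * p.+1%:R
        * psi (translate m (t p) x)
        + bump c r x * ((psi (translate m (t p) x) - psi x) * p.+1%:R))); last first.
      by apply/funext => p; rewrite /f /t; ring.
    apply: cvgD; last by apply: cvgM; [exact: cvg_cst|exact: translate_quotient_cvg].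
    apply: cvgM.
      (* Dividing the second-order remainder by the step [t p] leaves [64 / r ^+ 2 * t p], which
         tends to 0. *)
      apply/cvgrPdist_le => e e0; near=> p.
      have p0 : 0 < t p by rewrite invr_gt0.
      have := bump_translate m c x (t p) r0.
      have -> : p.+1%:R = (t p)^-1 by rewrite /t invrK.
      rewrite -(ler_pM2r (x := (t p)^-1)) ?invr_gt0//.
      rewrite -[X in _ * X](gtr0_norm (x := (t p)^-1)) ?invr_gt0// -normrM.
      rewrite distrC mulrBl [t p * _]mulrC mulfK ?gt_eqF// => H; apply: (le_trans H).
      rewrite expr2 mulrA mulfK ?gt_eqF//.
      near: p; have : (fun p : nat => 64 / r ^+ 2 * t p) @ \oo --> 64 / r ^+ 2 * (0 : R).
        by apply: cvgM; [exact: cvg_cst|exact: cvg_harmonic].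
      rewrite mulr0 => /cvgrPdist_le /(_ e e0); apply: filterS => p.
      by rewrite sub0r normrN; apply: le_trans; exact: ler_norm.
    have h := cvg_comp _ _ (@cvg_harmonic R) (@translate_continuous R n m x 0).
    by rewrite translate0 in h; exact: (cvg_comp _ _ h (cpsi x)).
move: f'0; rewrite /f'; under eq_integral do rewrite EFinD.
rewrite integralD//= => /eqP; rewrite addrC.
have := integrable_fin_num measurableT i2; have := integrable_fin_num measurableT i1.
rewrite /=; move: (integral _ _ _) (integral _ _ _) => a b.
by case: a => // a; case: b => // b _ _; rewrite -EFinD -EFinN eqe addr_eq0 => /eqP ->.
Unshelve. all: by end_near. Qed.

(** Dominated convergence on both sides: [psi] and its derivative are bounded on the cube that
    carries [F] and [G], so multiples of [F] and [G] are integrable majorants. *)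
Lemma ibp_lim m (f g : nat -> Bn -> R) (f0 g0 F G : Bn -> R) c r :
  (forall k, ibp m (f k) (g k)) ->
  (forall k, measurable_fun setT (f k)) -> (forall k, measurable_fun setT (g k)) ->
  (forall x, f ^~ x @ \oo --> f0 x) -> (forall x, g ^~ x @ \oo --> g0 x) ->
  (forall k x, `|f k x| <= F x) -> (forall k x, `|g k x| <= G x) ->
  lam.-integrable setT (EFin \o F) -> lam.-integrable setT (EFin \o G) ->
  (forall x, ~ cube c r x -> F x = 0) -> (forall x, ~ cube c r x -> G x = 0) ->
  ibp m f0 g0.
Proof.
move=> H mf mg ff gg fF gG iF iG F0 G0 psi Cpsi; have [dpsi cpsi cD] := Cpsi.
have dct (h : nat -> Bn -> R) (h0 Hd : Bn -> R) (w : 'rV[R]_n -> R) : continuous w ->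
    (forall k, measurable_fun setT (h k)) -> (forall x, h ^~ x @ \oo --> h0 x) ->
    (forall k x, `|h k x| <= Hd x) -> lam.-integrable setT (EFin \o Hd) ->
    (forall x, ~ cube c r x -> Hd x = 0) ->
    lam.-integrable setT (fun x => (h0 x * w x)%:E) /\
    ((fun k => \int[lam]_x (h k x * w x)%:E) @ \oo --> \int[lam]_x (h0 x * w x)%:E)%E.
  move=> cw mh hh hH iH H0.
  have [K K0 HK] := @continuous_bounded_cube R n w c r cw.
  have mw := continuous_measurable_Bn cw.
  have mh0 : measurable_fun setT h0 by apply: (measurable_fun_cvg mh) => x _; exact: hh.
  have [] := @dominated_convergence _ _ _ lam setT measurableT
    (fun k x => (h k x * w x)%:E) (fun x => (h0 x * w x)%:E) (fun x => K%:E * (Hd x)%:E)%E.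
  - by move=> k; apply/measurable_EFinP; exact: measurable_funM.
  - by apply/measurable_EFinP; exact: measurable_funM.
  - apply: aeW => x _; apply: cvg_EFin; first by near=> k.
    by apply: cvgM; [exact: hh|exact: cvg_cst].
  - exact: integrableZl.
  - apply: aeW => x k _ /=; rewrite -EFinM lee_fin normrM mulrC.
    have [xc|xc] := pselect (cube c r x); first by rewrite ler_pM// HK.
    by have := hH k x; rewrite H0// normr_le0 => /eqP ->; rewrite normr0 !mulr0.
  by move=> ? _.
have [i1 l1] := dct f f0 F _ cD mf ff fF iF F0.
have [i2 l2] := dct g g0 G _ cpsi mg gg gG iG G0.
split => //.
apply: (@cvg_unique _ (@ereal_hausdorff R) _ _ _ _ l1).
rewrite (_ : (fun _ => _) = (fun k => - \int[lam]_x (g k x * psi x)%:E)%E).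
  exact: cvgeN.
by apply/funext => k; case: (H k psi Cpsi).
Unshelve. all: by end_near. Qed.

End IntegrationByParts.

(** * Binary sums and binary digits *)

Section BinarySums.
Variable R : realType.
Variables (a : nat -> R) (t : R).
Hypothesis a_gt0 : forall k, 0 < a k.
Hypothesis t_gt0 : 0 < t.
Hypothesis t_lt : t < 1 / 2.
Hypothesis a_decr : forall k, a k.+1 <= t * a k.
Implicit Types w : nat -> bool.

Definition bsum w : R := limn (series (fun k => (w k)%:R * a k)).

Lemma geometric_noninc k l : (k <= l)%N -> a l <= a k.
Proof.
move=> /subnK <-; elim: (l - k)%N => // j IH; rewrite addSn.
by apply: le_trans IH; apply: (le_trans (a_decr _)); apply: ler_piMl; [exact: ltW|move: t_lt; lra].
Qed.

Lemma geometric_decay l j : a (l + j)%N <= t ^+ j * a l.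
Proof.
elim: j => [|j IH]; first by rewrite addn0 mul1r.
rewrite addnS exprS -mulrA; apply: (le_trans (a_decr _)).
by rewrite ler_pM2l.
Qed.

Let t1 : 0 < 1 - t. Proof. by move: t_lt; lra. Qed.

Lemma geometric_tail l N : \sum_(l <= k < N) a k <= a l / (1 - t).
Proof.
have [Nl|lN] := leqP N l.
  by rewrite big_geq// divr_ge0// ltW.
suff H j l' : \sum_(l' <= k < l' + j) a k <= a l' / (1 - t).
  by rewrite -(subnKC (ltnW lN)).
elim: j l' => [|j IH] l'.
  by rewrite big_geq ?addn0// divr_ge0// ltW.
rewrite big_ltn ?addnS ?ltnS ?leq_addr// -addSn.
apply: (le_trans (lerD (lexx _) (IH l'.+1))).
rewrite -[leLHS](mulfK (x := 1 - t)) ?gt_eqF// ler_pM2r ?invr_gt0// mulrDl divfK ?gt_eqF//.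
by have := a_decr l'; lra.
Qed.

Lemma bsum_cvg w : series (fun k => (w k)%:R * a k) @ \oo --> bsum w.
Proof.
apply: nondecreasing_is_cvgn.
  apply/nondecreasing_seqP => k; rewrite /series/= big_nat_recr//= lerDl.
  by rewrite mulr_ge0// ltW.
exists (a 0%N / (1 - t)) => _ [N _ <-]; rewrite /series/=.
apply: le_trans (geometric_tail 0 N); apply: ler_sum => k _.
by case: (w k); rewrite ?mul1r// mul0r ltW.
Qed.

Lemma bsum_diff_cvg w w' :
  (fun N => \sum_(0 <= k < N) ((w k)%:R - (w' k)%:R) * a k) @ \oo --> bsum w - bsum w'.
Proof.
rewrite (_ : (fun N => _) = (fun N => series (fun k => (w k)%:R * a k) N -
    series (fun k => (w' k)%:R * a k) N)).
  by apply: cvgB; exact: bsum_cvg.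
by apply/funext => N; rewrite /series/= -sumrB; apply: eq_bigr => k _; rewrite mulrBl.
Qed.

Lemma diff_tail w w' l N : `|\sum_(l <= k < N) ((w k)%:R - (w' k)%:R) * a k| <= a l / (1 - t).
Proof.
apply: le_trans (geometric_tail l N); apply: (le_trans (ler_norm_sum _ _ _)); apply: ler_sum => k _.
rewrite normrM (gtr0_norm (a_gt0 k)); apply: ler_piMl; first exact: ltW.
by case: (w k); case: (w' k); rewrite ?subrr ?subr0 ?sub0r ?normrN ?normr0 ?normr1.
Qed.

Lemma bsum_close w w' l : (forall k, (k < l)%N -> w k = w' k) ->
  `|bsum w - bsum w'| <= a l / (1 - t).
Proof.
move=> ww'; apply: (ler_cvg_to (cvg_norm (@bsum_diff_cvg w w')) (cvg_cst _)).
near=> N; have lN : (l <= N)%N by near: N; exact: nbhs_infty_ge.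
rewrite (big_cat_nat (n := l))//= big_nat_cond big1 ?add0r; first exact: diff_tail.
by move=> k; rewrite andbT => /andP[_ kl]; rewrite ww'// subrr mul0r.
Unshelve. all: by end_near. Qed.

(** The first differing term contributes [a l], the remaining ones at most [t * a l / (1 - t)], and
    [t < 1/2] makes the former win. *)
Lemma bsum_sep w w' l : (forall k, (k < l)%N -> w k = w' k) -> w l != w' l ->
  a l * ((1 - 2 * t) / (1 - t)) <= `|bsum w - bsum w'|.
Proof.
move=> ww' wl; apply: (ler_cvg_to (cvg_cst _) (cvg_norm (@bsum_diff_cvg w w'))).
near=> N; have lN : (l < N)%N by near: N; exact: nbhs_infty_gt.
rewrite (big_cat_nat (n := l))//= 1?ltnW// big_nat_cond big1 ?add0r; last first.
  by move=> k; rewrite andbT => /andP[_ kl]; rewrite ww'// subrr mul0r.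
rewrite big_ltn//; set S := \sum_(_ <= _ < _) _.
have HS : `|S| <= t * a l / (1 - t).
  apply: (le_trans (diff_tail _ _ _ _)); by rewrite ler_pM2r// invr_gt0.
have t1' : 1 - t != 0 by rewrite gt_eqF.
have -> : a l * ((1 - 2 * t) / (1 - t)) = a l - t * a l / (1 - t) by field.
have al : `|((w l)%:R - (w' l)%:R) * a l| = a l.
  rewrite normrM (gtr0_norm (a_gt0 l)); move: wl; case: (w l); case: (w' l) => // _.
    by rewrite subr0 normr1 mul1r.
  by rewrite sub0r normrN normr1 mul1r.
have := lerB_normD (((w l)%:R - (w' l)%:R) * a l) S; rewrite al; lra.
Unshelve. all: by end_near. Qed.

End BinarySums.

Lemma first_difference (w w' : nat -> bool) l : w l != w' l ->
  exists2 j, (j <= l)%N & w j != w' j /\ forall k, (k < j)%N -> w k = w' k.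
Proof.
move=> wl; have ex : exists k, w k != w' k by exists l.
case: (ex_minnP ex) => j wj jmin; exists j; first exact: jmin.
by split => // k kj; apply/eqP; apply: contraTT kj => /jmin; rewrite leqNgt.
Qed.

Section Digits.
Variable R : realType.
Local Notation mu := (@lebesgue_measure R).
Implicit Types x y : R.

Definition digit x (k : nat) : bool := odd (Num.truncn (2 ^+ k.+1 * x)).

Lemma truncn_half x : 0 <= x -> Num.truncn x = (Num.truncn (2 * x))./2.
Proof.
move=> x0; have x20 : 0 <= 2 * x by rewrite mulr_ge0.
apply/eqP; rewrite truncn_eq//; have /andP[] := truncn_itv x20.
set N := Num.truncn (2 * x) => h1 h2.
have NE : N%:R = (odd N)%:R + 2 * (N./2)%:R :> R.
  by rewrite -[in LHS](odd_double_half N) natrD -mul2n natrM.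
move: h1 h2; rewrite -[N.+1]addn1 natrD -[N./2.+1]addn1 natrD NE.
by case: (odd N) => /= h1 h2; apply/andP; split; lra.
Qed.

(** Integer parts obey [N_(k+1) = 2 N_k + digit x k] with [N_k] that of [2 ^+ k * x], so the digits
    determine them. *)
Lemma digits_truncn x y k : 0 <= x < 1 -> 0 <= y < 1 ->
  (forall j, (j < k)%N -> digit x j = digit y j) ->
  Num.truncn (2 ^+ k * x) = Num.truncn (2 ^+ k * y).
Proof.
move=> /andP[x0 x1] /andP[y0 y1]; elim: k => [|k IH] H.
  by rewrite !expr0 !mul1r (truncn_def (n := 0)) ?x0// (truncn_def (n := 0)) ?y0.
have e z : 0 <= z -> Num.truncn (2 ^+ k.+1 * z) = (digit z k + (Num.truncn (2 ^+ k * z)).*2)%N.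
  move=> z0; rewrite [in RHS]truncn_half; last by rewrite mulr_ge0// exprn_ge0.
  by rewrite mulrA -exprS odd_double_half.
by rewrite !e// H// IH// => j jk; apply: H; exact: ltnW.
Qed.

Lemma digits_interval x k : 0 <= x < 1 -> exists I : set R,
  [/\ measurable I, mu I = (2 ^- k)%:E &
   forall y, 0 <= y < 1 -> (forall j, (j < k)%N -> digit x j = digit y j) -> I y].
Proof.
move=> x01; pose N : R := (Num.truncn (2 ^+ k * x))%:R.
have p0 : (0 : R) < 2 ^+ k by rewrite exprn_gt0.
exists `[N / 2 ^+ k, (N + 1) / 2 ^+ k[%classic; split => //.
  rewrite lebesgue_measure_itv/= lte_fin ltr_pM2r ?invr_gt0// ltrDl ltr01 -EFinB.
  by congr (_%:E); field; rewrite gt_eqF.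
move=> y y01 /(digits_truncn x01 y01) e.
have /truncn_itv : 0 <= 2 ^+ k * y by rewrite mulr_ge0 ?(ltW p0)//; case/andP: y01.
rewrite -e -[(Num.truncn _).+1%:R]natr1 -/N => /andP[h1 h2]; rewrite /= in_itv/=.
by rewrite ler_pdivrMr// [X in _ <= X]mulrC h1/= ltr_pdivlMr// [X in X < _]mulrC.
Qed.

Lemma digits_inj x y : 0 <= x < 1 -> 0 <= y < 1 -> (forall j, digit x j = digit y j) -> x = y.
Proof.
move=> x01 y01 H; apply/eqP; rewrite -subr_eq0 -normr_eq0; apply/eqP.
apply/eqP; rewrite eq_le normr_ge0 andbT; apply/ler_addgt0Pr => e e0; rewrite add0r.
have [k ke] : exists k : nat, (2 ^- k : R) < e.
  have := @cvg_expr R (2^-1); rewrite ger0_norm ?invr_ge0// invf_lt1// ltr1n => /(_ isT).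
  move=> /cvgrPdist_lt /(_ e e0) [k _ /(_ k (leqnn k))].
  by rewrite /= sub0r normrN ger0_norm ?exprn_ge0 ?invr_ge0// exprVn => ?; exists k.
apply: le_trans (ltW ke).
have e2 := @digits_truncn x y k x01 y01 (fun j _ => H j).
have p0 : (0 : R) < 2 ^+ k by rewrite exprn_gt0.
have /truncn_itv : 0 <= 2 ^+ k * y by rewrite mulr_ge0 ?(ltW p0)//; case/andP: y01.
have /truncn_itv : 0 <= 2 ^+ k * x by rewrite mulr_ge0 ?(ltW p0)//; case/andP: x01.
rewrite e2 -[(Num.truncn _).+1%:R]natr1; move: (Num.truncn _)%:R => N /andP[h1 h2] /andP[h3 h4].
rewrite -[leRHS]mul1r ler_pdivlMr// -[X in _ * X](gtr0_norm p0) -normrM.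
by rewrite ler_norml; apply/andP; split; lra.
Qed.

End Digits.

(** * Hausdorff measures of sets coded by binary words *)

Section Distances.
Variables (R : realType) (n : nat).
Implicit Types (x y : 'rV[R]_n) (F : set 'rV[R]_n).

Lemma edist_ge_coord x y i : `|x ord0 i - y ord0 i| <= Defs.edist x y.
Proof.
rewrite -sqrtr_sqr ler_sqrt; last by apply: sumr_ge0 => j _; exact: sqr_ge0.
by rewrite (bigD1 i)//= lerDl; apply: sumr_ge0 => j _; exact: sqr_ge0.
Qed.

Lemma ediam_ge0 F : (0 <= ediam F)%E.
Proof. by apply: ereal_sup_ubound; left. Qed.

Lemma ediam_le F r : 0 <= r -> (forall x y, F x -> F y -> Defs.edist x y <= r) ->
  (ediam F <= r%:E)%E.
Proof.
move=> r0 H; apply: ge_ereal_sup => _ [->|[x Fx [y Fy <-]]]; first by rewrite lee_fin.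
by rewrite lee_fin; exact: H.
Qed.

Lemma edist_le_ediam F x y : F x -> F y -> ((Defs.edist x y)%:E <= ediam F)%E.
Proof. by move=> Fx Fy; apply: ereal_sup_ubound; right; exists x => //; exists y. Qed.

End Distances.

Section Hausdorff.
Variables (R : realType) (n : nat) (g : R -> R).
Local Notation mu := (@lebesgue_measure R).
Hypothesis g_mono : forall r s, 0 <= r -> r <= s -> g r <= g s.
Hypothesis g_ge0 : forall r, 0 <= r -> 0 <= g r.

(* Mass distribution: the binary digits of [0, 1) transport Lebesgue measure
   to the range of T, where a set of diameter less than theta k has mass at
   most 2^-(k+1). *)
Lemma hausdorff_pre_ge (T : (nat -> bool) -> 'rV[R]_n) (theta : nat -> R) (L delta : R) (K : nat) :
  0 <= L -> (forall k, 0 < theta k) -> (forall k, theta k.+1 <= theta k) ->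
  (forall e, 0 < e -> exists k, theta k <= e) ->
  (forall w w' k l, (l <= k)%N -> w l != w' l -> theta k <= Defs.edist (T w) (T w')) ->
  (forall k, (K <= k)%N -> L * 2 ^- k <= g (theta k)) ->
  delta < theta K ->
  (L%:E <= hausdorff_pre g delta (range T))%E.
Proof.
move=> L0 th0 thS thlim sep growth dK; apply: le_ereal_inf_tmp => _ [F [Fd Fcov] <-].
have th_mono i j : (i <= j)%N -> theta j <= theta i.
  move=> /subnK <-; elim: (j - i)%N => // l IH; rewrite addSn; exact: le_trans (thS _) IH.
have dfin i : ediam (F i) \is a fin_num.
  by rewrite ge0_fin_numE ?ediam_ge0// (le_lt_trans (Fd i))// ltry.
have d0 i : 0 <= fine (ediam (F i)) by rewrite fine_ge0// ediam_ge0.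
(* The parameters sent into [F i] need not form a measurable set; they are enclosed in a measurable
   [I] whose mass can be charged to [F i]. *)
have key i : exists I : set R, [/\ measurable I, (L%:E * mu I <= (g (fine (ediam (F i))))%:E)%E &
    forall x : R, 0 <= x < 1 -> F i (T (digit x)) -> I x].
  have [[x [x01 Fx]]|H] := pselect (exists x : R, 0 <= x < 1 /\ F i (T (digit x))); last first.
    exists set0; split => //; first by rewrite measure0 mule0 lee_fin g_ge0.
    by move=> x x01 Fx; apply: H; exists x.
  have agree (y : R) k : F i (T (digit y)) -> fine (ediam (F i)) < theta k ->
      forall j, (j < k.+1)%N -> digit x j = digit y j.
    move=> Fy dk j jk; apply/eqP; apply: contraTT dk => dj; rewrite -leNgt.
    rewrite -lee_fin fineK//; apply: le_trans (edist_le_ediam Fx Fy).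
    by rewrite lee_fin; exact: sep dj.
  (* Diameter zero is below every [theta]; the codes then agree in all digits, so a single parameter
     is left. *)
  have [dz|dz] := eqVneq (fine (ediam (F i))) 0.
    exists [set x]; split => //; first by rewrite lebesgue_measure_set1 mule0 lee_fin g_ge0.
    move=> y y01 Fy; apply/esym; apply: digits_inj => // j.
    by apply: (agree y j Fy) => //; rewrite dz.
  have dpos : 0 < fine (ediam (F i)) by rewrite lt_def dz d0.
  have ex : exists j, theta j <= fine (ediam (F i)) by exact: thlim.
  case: (ex_minnP ex) => j thj jmin.
  have dth : fine (ediam (F i)) < theta K.
    by apply: le_lt_trans dK; rewrite -lee_fin fineK.
  (* The first scale not exceeding the diameter has positive index, because the diameter is below
     [theta K]. From [theta j.+1 <= diam < theta j], the codes share [j.+1] digits: a mass of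
     [2 ^- j.+1] is compared with [g (theta j.+1)]. *)
  case: j thj jmin => [|j] thj jmin.
    by have := lt_le_trans (le_lt_trans thj dth) (th_mono 0%N K (leq0n K)); rewrite ltxx.
  have dj : fine (ediam (F i)) < theta j.
    by rewrite ltNge; apply/negP => /jmin; rewrite ltnn.
  have Kj : (K <= j.+1)%N.
    by rewrite leqNgt; apply/negP => /ltnW/th_mono h; have := le_lt_trans thj dth; lra.
  have [I [mI muI HI]] := digits_interval j.+1 x01.
  exists I; split => //; last by move=> y y01 Fy; apply: HI => //; exact: agree.
  rewrite [X in (_ * X)%E]muI -EFinM lee_fin; apply: (le_trans (growth _ Kj)).
  by apply: g_mono => //; exact: ltW.
pose I i := sval (cid (key i)).
have HI i : [/\ measurable (I i), (L%:E * mu (I i) <= (g (fine (ediam (F i))))%:E)%E &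
    forall x : R, 0 <= x < 1 -> F i (T (digit x)) -> I i x] by exact: (svalP (cid (key i))).
apply: (@le_trans _ _ (\sum_(i <oo) L%:E * mu (I i))%E); last first.
  apply: lee_nneseries => i _ //; last by case: (HI i).
  by rewrite mule_ge0// lee_fin.
rewrite nneseriesZl//.
rewrite -[leLHS]mule1; apply: lee_wpmul2l; first by rewrite lee_fin.
have -> : 1%E = mu `[0, 1[%classic.
  by rewrite lebesgue_measure_itv/= lte_fin ltr01 -EFinB subr0.
apply: measure_sigma_subadditive => //; first by move=> i; case: (HI i).
move=> x /=; rewrite in_itv/= => x01.
have [i _ Fi] : (\bigcup_i F i) (T (digit x)) by apply: Fcov; exists (digit x).
by exists i => //; case: (HI i) => _ _; apply.
Qed.

Lemma hausdorff_ge_pre delta (E : set 'rV[R]_n) : 0 < delta ->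
  (hausdorff_pre g delta E <= hausdorff g E)%E.
Proof. by move=> d0; apply: ereal_sup_ubound; exists delta. Qed.

(** Cover by the images of the [2^k] cylinders of length [k], completed by empty sets, which cost
    nothing as [g 0 = 0]. *)
Lemma hausdorff_le (T : (nat -> bool) -> 'rV[R]_n) (eta : nat -> R) (B : R) :
  g 0 = 0 -> (forall k, 0 <= eta k) ->
  (forall e, 0 < e -> exists k, eta k <= e) ->
  (forall w w' k, (forall l, (l < k)%N -> w l = w' l) -> Defs.edist (T w) (T w') <= eta k) ->
  (forall k, 2 ^+ k * g (eta k) <= B) ->
  (hausdorff g (range T) <= B%:E)%E.
Proof.
move=> g00 eta0 etalim close gB; apply: ge_ereal_sup => _ [delta /= d0 <-].
have [k kd] := etalim delta d0.
pose s : seq (k.-tuple bool) := enum {: k.-tuple bool}.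
have sz : size s = (2 ^ k)%N by rewrite -cardE card_tuple card_bool.
pose cyl (v : seq bool) : set (nat -> bool) := [set w | forall l, (l < k)%N -> w l = nth false v l].
pose F (i : nat) : set 'rV[R]_n := if (i < size s)%N then T @` cyl (nth [tuple of nseq k false] s i) else set0.
have Fdiam i : (ediam (F i) <= (eta k)%:E)%E.
  apply: ediam_le => // x y; rewrite /F; case: ifP => // _ [w cw <-] [w' cw' <-].
  by apply: close => l lk; rewrite cw// cw'.
have F0 i : (size s <= i)%N -> fine (ediam (F i)) = 0.
  move=> si; rewrite /F ltnNge si/=.
  suff -> : ediam (set0 : set 'rV[R]_n) = 0%E by [].
  by apply/eqP; rewrite eq_le ediam_ge0 andbT; exact: ediam_le.
apply: (@le_trans _ _ (\sum_(i <oo) (g (fine (ediam (F i))))%:E)%E).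
  apply: ereal_inf_lbound; exists F => //; split.
    by move=> i; rewrite (le_trans (Fdiam i))// lee_fin.
  move=> _ [w _ <-]; pose v := [tuple w i | i < k].
  exists (index v s) => //; rewrite /F index_mem mem_enum/= nth_index ?mem_enum//.
  by exists w => // l lk; rewrite (nth_map (Ordinal lk)) ?size_enum_ord// nth_enum_ord.
rewrite (nneseries_split 0 (size s)); last by move=> i _; rewrite lee_fin g_ge0// fine_ge0// ediam_ge0.
rewrite add0n [X in (_ + X)%E]eseries0 ?adde0; last by move=> i si _; rewrite F0// g00.
rewrite sumEFin lee_fin; apply: le_trans (gB k).
rewrite -[2 ^+ k]natrX -sz mulr_natl -[X in _ *+ X]subn0 -sumr_const_nat.
apply: ler_sum => i _; apply: g_mono; first by rewrite fine_ge0// ediam_ge0.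
rewrite -lee_fin fineK//.
by rewrite ge0_fin_numE ?ediam_ge0// (le_lt_trans (Fdiam i))// ltry.
Qed.

End Hausdorff.

(** * Nested cutoffs around the Cantor set *)

Section Construction.
Variables (R : realType) (p : nat).
Local Notation n := p.+1.
Variables (J M : nat -> nat).
Hypothesis J_gt0 : forall k, (0 < J k)%N.
Hypothesis M_succ : forall k, M k.+1 = (M k + J k + 3)%N.
Implicit Types (x : 'rV[R]_n) (w : nat -> bool) (v : seq bool) (k j : nat).

Definition del k : R := 2 ^- M k.
Definition rad k j : R := 2 ^- (M k + 2 + j).
Definition pos w : R := bsum del w.
Definition line (a : R) : 'rV[R]_n := \row_i (if i == ord0 then a else 0).
(* The word v of length k, followed by 1 and then by 0s. *)
Definition ext k v l : bool := if (l < k)%N then nth false v l else l == k.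
(** Centres carry the digit 1 at place [k], since the cutoff of generation [k] has to be 1 near the
    points with that digit and 0 near the others. *)
Definition center k v : 'rV[R]_n := line (pos (ext k v)).

(** The cube without the half cube on which the bump is constantly 1: only there can a derivative of
    the bump be nonzero. *)
Definition active k j v x := cube (center k v) (rad k j) x /\
  exists i, rad k j / 2 < `|x ord0 i - center k v ord0 i|.

Lemma pow2_gt0 j : 0 < 2 ^- j :> R.
Proof. by rewrite invr_gt0 exprn_gt0. Qed.

Lemma pow2_add i j : 2 ^- (i + j) = 2 ^- i * 2 ^- j :> R.
Proof. by rewrite exprD invfM. Qed.

Lemma pow2_le i j : (i <= j)%N -> 2 ^- j <= 2 ^- i :> R.
Proof. by move=> ij; rewrite lef_pV2 ?posrE ?exprn_gt0// ler_weXn2l// ler1n. Qed.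

Lemma del_gt0 k : 0 < del k. Proof. exact: pow2_gt0. Qed.
Lemma rad_gt0 k j : 0 < rad k j. Proof. exact: pow2_gt0. Qed.

(** [J k >= 1] makes [M] grow by at least 4. *)
Lemma del_decr k : del k.+1 <= 16^-1 * del k.
Proof.
rewrite /del (_ : 16^-1 = 2 ^- 4); last by congr (_^-1); ring.
rewrite -pow2_add; apply: pow2_le; have := J_gt0 k; rewrite M_succ; lia.
Qed.

Lemma del_noninc k l : (k <= l)%N -> del l <= del k.
Proof. apply: (geometric_noninc del_gt0 _ del_decr); lra. Qed.

Lemma radE k j : rad k j = del k / 4 * 2 ^- j.
Proof.
by rewrite /rad /del !pow2_add; congr (_ * _ * _); congr (_^-1); ring.
Qed.

Lemma rad_noninc k i j : (i <= j)%N -> rad k j <= rad k i.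
Proof. by move=> ij; apply: pow2_le; lia. Qed.

Lemma rad_le k j : rad k j <= del k / 4.
Proof.
rewrite radE; apply: ler_piMr; first by rewrite divr_ge0// ltW// del_gt0.
by have := pow2_le (leq0n j); rewrite expr0 invr1.
Qed.

Lemma rad_half k j : rad k j / 2 = rad k j.+1.
Proof. by rewrite /rad (addnS (M k + 2)) exprS invfM mulrC. Qed.

(** The 3 in the recursion of [M] is chosen for this. Even the smallest half cube of generation [k]
    has room for the next piece, whose points lie within [3/2 * del k.+1] of the centre. *)
Lemma rad_ge k j : (j < J k)%N -> 2 * del k.+1 <= rad k j / 2.
Proof.
move=> jJ; rewrite rad_half /del M_succ /rad.
rewrite (_ : (M k + J k + 3 = (M k + J k + 2).+1)%N); last by lia.
rewrite exprS invfM mulrA divff ?mul1r ?pnatr_eq0//; apply: pow2_le; lia.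
Qed.

Lemma pos_close w w' k : (forall l, (l < k)%N -> w l = w' l) ->
  `|pos w - pos w'| <= 3 / 2 * del k.
Proof.
move=> H; have t1 : 16^-1 < 1 / 2 :> R by lra.
have := bsum_close del_gt0 t1 del_decr H; move/le_trans; apply.
by have := del_gt0 k; rewrite ler_pdivrMr; lra.
Qed.

Lemma pos_sep w w' k l : (l <= k)%N -> w l != w' l -> del k / 2 <= `|pos w - pos w'|.
Proof.
move=> lk /first_difference [j jl [wj H]].
have t1 : 16^-1 < 1 / 2 :> R by lra.
have := bsum_sep del_gt0 t1 del_decr H wj; apply: le_trans.
have := del_noninc (leq_trans jl lk); have := del_gt0 j.
have -> : (1 - 2 * 16^-1) / (1 - 16^-1) = 14 / 15 :> R by field.
lra.
Qed.

Lemma line_coord a i : line a ord0 i = if i == ord0 then a else 0.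
Proof. by rewrite mxE. Qed.

Lemma cube_pos k v r x : cube (center k v) r x -> `|x ord0 ord0 - pos (ext k v)| < r.
Proof. by move=> /(_ ord0); rewrite line_coord eqxx. Qed.

(** Centres of different words are at least [del k / 2] apart, and each radius is at most
    [del k / 4]. *)
Lemma center_unique k (v v' : k.-tuple bool) j j' x :
  cube (center k v) (rad k j) x -> cube (center k v') (rad k j') x -> v = v'.
Proof.
move=> /cube_pos h1 /cube_pos h2; apply: contrapT => vv'.
have [l lk dl] : exists2 l, (l < k)%N & nth false v l != nth false v' l.
  apply: contrapT => H; apply: vv'; apply: eq_from_tnth => i.
  rewrite !(tnth_nth false); apply/eqP; apply: contrapT => /negP d.
  by apply: H; exists i.
have : ext k v l != ext k v' l by rewrite /ext lk.
move=> /(pos_sep (ltnW lk)); have := rad_le k j; have := rad_le k j'.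
move: h1 h2; rewrite !ltr_norml => /andP[? ?] /andP[? ?] ? ?.
by rewrite leNgt ltr_norml; apply/negP/negPn/andP; split; lra.
Qed.

(** If the two codes agree through place [k], the later cube is within [3/2 * del k.+1 + del k' / 4
    < 2 * del k.+1] of the centre, hence inside the half cube. If they split at a place at most [k],
    the cubes are too far apart to meet. *)
Lemma active_generation k j v k' j' v' x : (k < k')%N -> (j < J k)%N ->
  active k j v x -> cube (center k' v') (rad k' j') x -> False.
Proof.
move=> kk' jJ [xc [i Hi]] xc'.
have d1 : del k' <= del k.+1 by apply: del_noninc.
have d2 : del k.+1 <= 16^-1 * del k := del_decr k.
have d0 := del_gt0 k'; have rk' := rad_le k' j'; have rk := rad_le k j.
have [H|/existsNP [l /not_implyP [lk dl]]] := pselect (forall l, (l < k.+1)%N -> ext k v l = ext k' v' l).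
  have := pos_close H; have := xc' i; have := rad_ge jJ; move: Hi; rewrite !line_coord.
  case: (i == ord0).
    rewrite !ltr_norml ler_norml => h1 h2 /andP[h3 h4] /andP[h5 h6].
    move: h1; rewrite ltNge ler_norml => /negP; apply; apply/andP; split; lra.
  rewrite ltr_norml subr0 => h1 h2 /andP[h3 h4] _.
  by move: h1; rewrite ltNge ler_norml => /negP; apply; apply/andP; split; lra.
have : ext k v l != ext k' v' l by apply/eqP.
move=> /(pos_sep (_ : (l <= k)%N)) -/(_ lk).
have := cube_pos xc; have := cube_pos xc'.
rewrite !ltr_norml => /andP[? ?] /andP[? ?].
by rewrite leNgt ltr_norml; apply/negP/negPn/andP; split; lra.
Qed.

Lemma active_scale k j v j' x : (j < j')%N -> active k j v x ->
  cube (center k v) (rad k j') x -> False.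
Proof.
move=> jj' [_ [i Hi]] /(_ i) H.
have := rad_noninc k jj'; rewrite -rad_half => h.
by have := lt_trans Hi H; rewrite ltNge h.
Qed.

Lemma active_unique k j (v : k.-tuple bool) k' j' (v' : k'.-tuple bool) x :
  (j < J k)%N -> (j' < J k')%N -> active k j v x -> active k' j' v' x ->
  [/\ k = k', j = j' & v = v' :> seq bool].
Proof.
move=> jJ jJ' a a'; have [kk'|kk'|kk'] := ltngtP k k'.
- by have := active_generation kk' jJ a (proj1 a').
- by have := active_generation kk' jJ' a' (proj1 a).
subst k'; have vv' := center_unique (proj1 a) (proj1 a'); subst v'; split => //.
have [jj'|jj'|//] := ltngtP j j'.
- by have := active_scale jj' a (proj1 a').
- by have := active_scale jj' a' (proj1 a).
Qed.

Definition cutoff k x : R := (J k)%:R^-1 *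
  \sum_(j < J k) \sum_(v : k.-tuple bool) bump (center k v) (rad k j) x.

Definition dcutoff m k x : R := (J k)%:R^-1 *
  \sum_(j < J k) \sum_(v : k.-tuple bool) dbump m (center k v) (rad k j) x.

Lemma cutoff_continuous k : continuous (cutoff k).
Proof.
move=> x; have FF := nbhs_filter x; apply: (@cvgM _ _ (nbhs x) FF); first exact: cvg_cst.
move: {FF} x; apply: (@continuous_big R _ +%R 0 xpredT (@add_continuous R^o) _ (index_enum _)
  (fun (j : 'I_(J k)) x => \sum_(v : k.-tuple bool) bump (center k v) (rad k j) x)) => j _.
apply: (@continuous_big R _ +%R 0 xpredT (@add_continuous R^o) _ (index_enum _)
  (fun (v : k.-tuple bool) x => bump (center k v) (rad k j) x)) => v _.
exact: bump_continuous.
Qed.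

Lemma dcutoff_continuous m k : continuous (dcutoff m k).
Proof.
move=> x; have FF := nbhs_filter x; apply: (@cvgM _ _ (nbhs x) FF); first exact: cvg_cst.
move: {FF} x; apply: (@continuous_big R _ +%R 0 xpredT (@add_continuous R^o) _ (index_enum _)
  (fun (j : 'I_(J k)) x => \sum_(v : k.-tuple bool) dbump m (center k v) (rad k j) x)) => j _.
apply: (@continuous_big R _ +%R 0 xpredT (@add_continuous R^o) _ (index_enum _)
  (fun (v : k.-tuple bool) x => dbump m (center k v) (rad k j) x)) => v _.
exact: dbump_continuous.
Qed.

Lemma sum_bump_le1 k j x : \sum_(v : k.-tuple bool) bump (center k v) (rad k j) x <= 1.
Proof.
have [[v xc]|H] := pselect (exists v : k.-tuple bool, cube (center k v) (rad k j) x).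
  rewrite (bigD1 v)//= big1 ?addr0 ?bump_le1// => v' vv'.
  apply: bump_eq0; first exact: rad_gt0.
  by move=> xc'; move: vv'; rewrite (center_unique xc xc') eqxx.
rewrite big1// => v _; apply: bump_eq0; first exact: rad_gt0.
by move=> xc; apply: H; exists v.
Qed.

Lemma cutoff_ge0 k x : 0 <= cutoff k x.
Proof.
apply: mulr_ge0; first by rewrite invr_ge0.
apply: sumr_ge0 => j _; apply: sumr_ge0 => v _.
exact: bump_ge0.
Qed.

Lemma cutoff_le1 k x : cutoff k x <= 1.
Proof.
rewrite /cutoff mulrC ler_pdivrMr ?ltr0n// mul1r.
apply: (@le_trans _ _ (\sum_(j < J k) 1)); last by rewrite sumr_const card_ord.
by apply: ler_sum => j _; exact: sum_bump_le1.
Qed.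

(** If [w k] is 1, the point lies in the half cube of its own word at each of the [J k] scales, and
    every bump there equals 1. All other centres are at least [del k / 2] away, beyond the
    radius. *)
Lemma cutoff_pos k w : cutoff k (line (pos w)) = (w k)%:R.
Proof.
have Jk0 : (J k)%:R != 0 :> R by rewrite pnatr_eq0 -lt0n.
have cubeN (v : k.-tuple bool) j : (exists2 l, (l <= k)%N & w l != ext k v l) ->
    ~ cube (center k v) (rad k j) (line (pos w)).
  move=> [l lk /(pos_sep lk) H] /cube_pos; rewrite line_coord eqxx => h.
  by have := rad_le k j; have := del_gt0 k; lra.
case wk : (w k); last first.
  rewrite /cutoff big1 ?mulr0// => j _; rewrite big1// => v _.
  apply: bump_eq0; first exact: rad_gt0.
  by apply: cubeN; exists k => //; rewrite wk /ext ltnn eqxx.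
pose v : k.-tuple bool := [tuple w i | i < k].
have vE l : (l < k)%N -> nth false v l = w l.
  by move=> lk; rewrite -(tnth_nth false v (Ordinal lk)) tnth_mktuple.
rewrite /cutoff (eq_bigr (fun=> 1)); first by rewrite sumr_const card_ord mulVf.
move=> j _; rewrite (bigD1 v)//= big1 ?addr0.
  apply: bump_eq1; first exact: rad_gt0.
  have H : forall l, (l < k.+1)%N -> w l = ext k v l.
    by move=> l; rewrite ltnS leq_eqVlt /ext => /predU1P[->|lk]; [rewrite ltnn eqxx|rewrite lk vE].
  move=> i; rewrite !line_coord; have := rad_ge (ltn_ord j); have := del_gt0 k.+1.
  case: (i == ord0); first by have := pos_close H; lra.
  by rewrite subrr normr0; lra.
move=> v' vv'; apply: bump_eq0; first exact: rad_gt0.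
apply: cubeN; apply: contrapT => H; move/negP: vv'; apply; apply/eqP.
apply: eq_from_tnth => i; rewrite !(tnth_nth false).
apply/eqP; apply: contrapT => /negP d; apply: H; exists i; first exact: ltnW.
by rewrite /ext ltn_ord -vE// eq_sym.
Qed.

Lemma dbump_active m k j v x : dbump m (center k v) (rad k j) x != 0 -> active k j v x.
Proof.
move=> d; split.
  by apply: contrapT => xc; move: d; rewrite dbump_eq0 ?rad_gt0// eqxx.
exists m; rewrite ltNge; apply/negP => H; move: d.
by rewrite dbump_eq0_in ?rad_gt0// eqxx.
Qed.

Definition shell k x := exists j (v : k.-tuple bool), (j < J k)%N /\ active k j v x.

Lemma dcutoff_shell m k x : dcutoff m k x != 0 -> shell k x.
Proof.
move=> H; apply: contrapT => NS; move: H; rewrite /dcutoff big1 ?mulr0 ?eqxx// => j _.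
rewrite big1// => v _; apply/eqP; apply: contrapT => /negP /dbump_active a.
by apply: NS; exists j, v.
Qed.

Lemma shell_unique k k' x : shell k x -> shell k' x -> k = k'.
Proof.
by move=> [j [v [jJ a]]] [j' [v' [jJ' a']]]; case: (active_unique jJ jJ' a a').
Qed.

Lemma dcutoff_active m k j (v : k.-tuple bool) x : (j < J k)%N -> active k j v x ->
  dcutoff m k x = (J k)%:R^-1 * dbump m (center k v) (rad k j) x.
Proof.
move=> jJ a; rewrite /dcutoff; congr (_ * _).
rewrite (bigD1 (Ordinal jJ))//= (bigD1 v)//= big1 ?addr0 ?big1 ?addr0// => [j' jj'|v' vv'].
  rewrite big1// => v' _; apply/eqP; apply: contrapT => /negP /dbump_active a'.
  have [_ jE _] := active_unique jJ (ltn_ord j') a a'.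
  by move/negP: jj'; apply; apply/eqP/val_inj.
apply/eqP; apply: contrapT => /negP /dbump_active a'.
have [_ _ vE] := active_unique jJ jJ a a'.
by move/negP: vv'; apply; apply/eqP/val_inj.
Qed.

Lemma pos_bound w : `|pos w| <= 3 / 2.
Proof.
have t1 : 16^-1 < 1 / 2 :> R by lra.
have -> : pos w = pos w - pos (fun=> false).
  rewrite (_ : pos (fun=> false) = 0) ?subr0//.
  apply: (@cvg_lim R^o); first exact: Rhausdorff.
  by apply: cvg_near_cst; near=> N; rewrite /series/= big1// => k _; rewrite mul0r.
apply: (le_trans (@pos_close w (fun=> false) 0 _)) => //.
have : del 0 <= 1 by have := pow2_le (leq0n (M 0)); rewrite expr0 invr1.
lra.
Unshelve. all: by end_near. Qed.

Lemma center_cube k v j x : cube (center k v) (rad k j) x -> cube 0 2 x.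
Proof.
move=> xc i; have := xc i; rewrite !line_coord mxE subr0.
have := pos_bound (ext k v); have := rad_le k j.
have : del k <= 1 by have := pow2_le (leq0n (M k)); rewrite expr0 invr1.
case: (i == ord0); last by rewrite subr0; lra.
rewrite !ltr_norml ler_norml => ? ? /andP[? ?] /andP[? ?]; apply/andP; split; lra.
Qed.

Lemma cutoff_support k x : ~ cube 0 2 x -> cutoff k x = 0.
Proof.
move=> xc; rewrite /cutoff big1 ?mulr0// => j _; rewrite big1// => v _.
by apply: bump_eq0; [exact: rad_gt0|move=> /center_cube].
Qed.

Lemma shell_support k x : shell k x -> cube 0 2 x.
Proof. by move=> [j [v [_ [/center_cube]]]]. Qed.

End Construction.

(** * The Sobolev map *)

Section SobolevMap.
Variables (R : realType) (p : nat).
Local Notation n := p.+1.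
Local Notation Bn := (Bn R n).
Variables (J M : nat -> nat).
Hypothesis J_gt0 : forall k, (0 < J k)%N.
Hypothesis M_succ : forall k, M k.+1 = (M k + J k + 3)%N.
Variables (s : nat -> R) (t : R).
Hypothesis s_gt0 : forall k, 0 < s k.
Hypothesis t_lt : t < 1 / 2.
Hypothesis s_decr : forall k, s (k + n)%N <= t * s k.
Implicit Types (x : 'rV[R]_n) (w : nat -> bool) (v : seq bool) (k j : nat) (i m : 'I_n).

Local Notation pos := (pos R M).
Local Notation rad := (rad R M).
Local Notation center := (@center R p M).
Local Notation active := (@active R p M).
Local Notation cutoff := (@cutoff R p J M).
Local Notation dcutoff := (@dcutoff R p J M).
Local Notation shell := (@shell R p J M).
Local Notation line := (@line R p).

(** The amplitudes of the generations congruent to [i] modulo [n], which alone move coordinate [i];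
    their ratio is at most [t < 1/2]. *)
Definition strided i r : R := s (r * n + i).

Lemma strided_gt0 i r : 0 < strided i r. Proof. exact: s_gt0. Qed.

Lemma strided_decr i r : strided i r.+1 <= t * strided i r.
Proof. by rewrite /strided mulSn -addnA addnC s_decr. Qed.

Definition umap x : 'rV[R]_n := \row_i limn (series (fun r => strided i r * cutoff (r * n + i) x)).

Definition upart i N x : R := \sum_(0 <= r < N) strided i r * cutoff (r * n + i) x.

Lemma upart_cvg i x : (fun N => upart i N x) @ \oo --> umap x ord0 i.
Proof.
rewrite mxE; apply: nondecreasing_is_cvgn.
  apply/nondecreasing_seqP => N; rewrite /upart big_nat_recr//= lerDl.
  by rewrite mulr_ge0 ?cutoff_ge0// ltW// strided_gt0.
exists (strided i 0 / (1 - t)) => _ [N _ <-]; rewrite /upart.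
apply: le_trans (geometric_tail (strided_gt0 i) t_lt (strided_decr i) 0 N); apply: ler_sum => r _.
by rewrite ler_piMr ?cutoff_le1// ltW// strided_gt0.
Qed.

Lemma upart_ge0 i N x : 0 <= upart i N x.
Proof. by apply: sumr_ge0 => r _; rewrite mulr_ge0 ?cutoff_ge0// ltW// strided_gt0. Qed.

Lemma upart_mono i N N' x : (N <= N')%N -> upart i N x <= upart i N' x.
Proof.
move=> NN'; rewrite /upart (big_cat_nat (n := N) (p := N'))//= lerDl.
by apply: sumr_ge0 => r _; rewrite mulr_ge0 ?cutoff_ge0// ltW// strided_gt0.
Qed.

Lemma upart_dist i N N' x : (N <= N')%N -> upart i N' x - upart i N x <= strided i N / (1 - t).
Proof.
move=> NN'; rewrite /upart (big_cat_nat (n := N) (p := N'))//= addrAC subrr add0r.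
apply: le_trans (geometric_tail (strided_gt0 i) t_lt (strided_decr i) N N'); apply: ler_sum => r _.
by rewrite ler_piMr ?cutoff_le1// ltW// strided_gt0.
Qed.

Lemma upart_le i N x : upart i N x <= umap x ord0 i.
Proof.
apply: (ler_cvg_to (cvg_cst _) (@upart_cvg i x)); near=> N'; apply: upart_mono.
by near: N'; exact: nbhs_infty_ge.
Unshelve. all: by end_near. Qed.

Lemma umap_dist i N x : umap x ord0 i - upart i N x <= strided i N / (1 - t).
Proof.
have h := cvgB (@upart_cvg i x) (cvg_cst (upart i N x)).
apply: (ler_cvg_to (h _ _) (cvg_cst _)); near=> N'; apply: upart_dist.
by near: N'; exact: nbhs_infty_ge.
Unshelve. all: by end_near. Qed.

Lemma upart_continuous i N : continuous (upart i N).
Proof.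
apply: (@continuous_big R _ +%R 0 xpredT (@add_continuous R^o) _ _
  (fun r x => strided i r * cutoff (r * n + i) x)) => r _ x.
have FF := nbhs_filter x; apply: (@cvgM _ _ (nbhs x) FF); first exact: cvg_cst.
exact: cutoff_continuous.
Qed.

Lemma strided_tail_small i e : 0 < e -> exists N, strided i N / (1 - t) < e.
Proof.
move=> e0; have t1 : 0 < 1 - t by move: t_lt; lra.
have t0 : 0 < t.
  by have := lt_le_trans (s_gt0 (0 + n)) (s_decr 0); rewrite pmulr_lgt0.
have [N HN] : exists N, t ^+ N < e * (1 - t) / strided i 0.
  have e'0 : 0 < e * (1 - t) / strided i 0 by rewrite divr_gt0 ?mulr_gt0// strided_gt0.
  have := @cvg_expr R t; rewrite gtr0_norm// (lt_trans t_lt) => [/(_ isT)|]; last by lra.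
  move=> /cvgrPdist_lt /(_ _ e'0) [N _ /(_ N (leqnn N))].
  by rewrite /= sub0r normrN ger0_norm ?exprn_ge0 ?(ltW t0)// => ?; exists N.
exists N; rewrite ltr_pdivrMr//; apply: (le_lt_trans (geometric_decay t0 (strided_decr i) 0 N)).
by rewrite -ltr_pdivlMr// strided_gt0.
Qed.

Lemma umap_coord_continuous i : continuous (fun x => umap x ord0 i).
Proof.
move=> x; have FF := nbhs_filter x; apply/cvgrPdist_lt => e e0.
have e30 : 0 < e / 3 by rewrite divr_gt0.
have [N HN] := strided_tail_small i e30.
have /cvgrPdist_lt /(_ _ e30) := @upart_continuous i N x; apply: (@filterS _ (nbhs x) FF) => y.
have := umap_dist i N x; have := umap_dist i N y.
have := upart_le i N x; have := upart_le i N y.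
move=> ? ? ? ?; rewrite !ltr_norml => /andP[? ?]; apply/andP; split; lra.
Qed.

Lemma umap_continuous : continuous umap.
Proof.
move=> x; have FF := nbhs_filter x; apply/(@cvg_ballP _ _ _ (nbhs x) FF) => e e0.
have : \forall y \near x, forall i, `|umap x ord0 i - umap y ord0 i| < e.
  apply: (@filter_forall _ _ _ (nbhs x) FF) => i.
  by have /cvgrPdist_lt := @umap_coord_continuous i x; apply.
apply: (@filterS _ (nbhs x) FF) => y H; rewrite -cubeE// => i.
by rewrite distrC.
Qed.

Lemma umap_support x i : ~ cube 0 2 x -> umap x ord0 i = 0.
Proof.
move=> xc; rewrite mxE; apply: (@cvg_lim R^o); first exact: Rhausdorff.
apply: cvg_near_cst; near=> N; rewrite /series/= big1// => r _.
by rewrite cutoff_support ?mulr0.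
Unshelve. all: by end_near. Qed.

Lemma umap_line w i : umap (line (pos w)) ord0 i = bsum (strided i) (fun r => w (r * n + i)%N).
Proof.
rewrite mxE /bsum; congr (limn _); congr series; apply/funext => r.
by rewrite cutoff_pos// mulrC.
Qed.

Definition gpart i m N x : R := \sum_(0 <= r < N) strided i r * dcutoff m (r * n + i) x.

Definition grad x : 'M[R]_n := \matrix_(i, m) limn (fun N => gpart i m N x).

(* Bounds the gradient of the map on the shells of generation k and radius rad k j. *)
Definition esize k j : R := 4 * s k / ((J k)%:R * rad k j).

Lemma esize_gt0 k j : 0 < esize k j.
Proof. by rewrite divr_gt0 ?mulr_gt0 ?rad_gt0// ltr0n. Qed.

Lemma single_term (f : nat -> R) r0 N : (forall r, r != r0 -> f r = 0) ->
  \sum_(0 <= r < N) f r = if (r0 < N)%N then f r0 else 0.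
Proof.
move=> H; rewrite big_mkord; case: ifPn => [h|h].
  rewrite (bigD1 (Ordinal h))//= big1 ?addr0// => r rr; apply: H.
  by apply: contraNneq rr => rr; apply/eqP/val_inj.
rewrite big1// => r _; apply: H; apply: contraNneq h => <-; exact: ltn_ord.
Qed.

(** Shells of different generations are disjoint, so at most one generation contributes at [x]:
    partial sums are 0 before its index and equal to the limit afterwards. Thus the limit bounds all
    partial sums. *)
Lemma gpart_cases x :
  (forall i m N, gpart i m N x = 0 /\ grad x i m = 0) \/
  exists k j (v : k.-tuple bool), [/\ (j < J k)%N, active k j v x &
    forall i m, [/\ `|grad x i m| <= esize k j,
      forall N, `|gpart i m N x| <= `|grad x i m| &
      (fun N => gpart i m N x) @ \oo --> grad x i m]].
Proof.
have [[k [j [v [jJ a]]]]|H] := pselect (exists k, shell k x); last first.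
  left => i m N.
  have g0 N' : gpart i m N' x = 0.
    rewrite /gpart big1// => r _; rewrite (_ : dcutoff _ _ _ = 0) ?mulr0//.
    apply/eqP; apply: contrapT => /negP /(@dcutoff_shell _ _ _ _) S.
    by apply: H; exists (r * n + i)%N.
  split => //; rewrite mxE; apply: (@cvg_lim R^o); first exact: Rhausdorff.
  by apply: cvg_near_cst; near=> N'.
right; exists k, j, v; split => // i m.
have S : shell k x by exists j, v.
have z r : (r * n + i)%N != k -> strided i r * dcutoff m (r * n + i) x = 0.
  move=> rk; rewrite (_ : dcutoff _ _ _ = 0) ?mulr0//.
  apply/eqP; apply: contrapT => /negP /(@dcutoff_shell _ _ _ _) S'.
  by move: rk; rewrite (shell_unique J_gt0 M_succ S' S) eqxx.
pose f r := strided i r * dcutoff m (r * n + i) x.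
(* [r * n + i = k] forces [r = k %/ n]. *)
have z' r : r != (k %/ n)%N -> f r = 0.
  move=> rk; apply: z; apply: contraNneq rk => <-.
  by rewrite divnMDl// divn_small ?addn0.
have gE N : gpart i m N x = if (k %/ n < N)%N then f (k %/ n)%N else 0.
  exact: single_term.
have cv : (fun N => gpart i m N x) @ \oo --> f (k %/ n)%N.
  apply: cvg_near_cst; near=> N; rewrite gE ifT//.
  by near: N; exact: nbhs_infty_gt.
have gradE : grad x i m = f (k %/ n)%N.
  by rewrite mxE; apply: (@cvg_lim R^o) => //; exact: Rhausdorff.
split; last by rewrite gradE.
  (* If [i] is not the residue of [k] modulo [n], generation [k] does not move coordinate [i] and
     the entry is 0. *)
  rewrite gradE /f; have [e|e] := eqVneq (k %/ n * n + i)%N k; last first.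
    by rewrite z// normr0 ltW// esize_gt0.
  rewrite /strided e (dcutoff_active J_gt0 M_succ _ jJ a) normrM (gtr0_norm (s_gt0 k)) normrM.
  rewrite gtr0_norm ?invr_gt0 ?ltr0n//.
  have -> : esize k j = s k * ((J k)%:R^-1 * (4 / rad k j)).
    by rewrite /esize; field; rewrite !gt_eqF ?rad_gt0 ?ltr0n.
  by rewrite !ler_pM2l ?invr_gt0 ?ltr0n// dbump_bound// rad_gt0.
by move=> N; rewrite gE gradE; case: ifP => // _; rewrite normr0.
Unshelve. all: by end_near. Qed.

Lemma gpart_continuous i m N : continuous (gpart i m N).
Proof.
apply: (@continuous_big R _ +%R 0 xpredT (@add_continuous R^o) _ _
  (fun r x => strided i r * dcutoff m (r * n + i) x)) => r _ x.
have FF := nbhs_filter x; apply: (@cvgM _ _ (nbhs x) FF); first exact: cvg_cst.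
exact: dcutoff_continuous.
Qed.

Lemma gpart_cvg i m x : (fun N => gpart i m N x) @ \oo --> grad x i m.
Proof.
have [H|[k [j [v [_ _ H]]]]] := gpart_cases x; last by case: (H i m).
by apply: cvg_near_cst; near=> N; have [-> ->] := H i m N.
Unshelve. all: by end_near. Qed.

Lemma gpart_le i m N x : `|gpart i m N x| <= `|grad x i m|.
Proof.
have [H|[k [j [v [_ _ H]]]]] := gpart_cases x; last by case: (H i m).
by have [-> ->] := H i m N.
Qed.

Lemma grad_measurable i m : measurable_fun setT ((fun x => grad x i m) : Bn -> R).
Proof.
apply: (@measurable_fun_cvg _ Bn R setT (gpart i m)); last by move=> x _; exact: gpart_cvg.
by move=> N; apply: continuous_measurable_Bn; exact: gpart_continuous.
Qed.

Lemma grad_support i m x : ~ cube 0 2 x -> grad x i m = 0.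
Proof.
move=> xc; have [H|[k [j [v [jJ a _]]]]] := gpart_cases x; first by have [] := H i m 0%N.
by exfalso; apply: xc; apply: (shell_support J_gt0 M_succ); exists j, v.
Qed.

Section WithMeasure.
Variable lam : {measure set Bn -> \bar R}.
Hypothesis Hlam : lebesgue_Rn lam.

(** Shells are enlarged to full cubes, whose measure is known exactly, at the price of a bounded
    factor. The coefficients are extended reals because [A] takes its values there. *)
Definition dominator (b : nat -> nat -> \bar R) (x : Bn) : \bar R :=
  (\sum_(k <oo) \sum_(j < J k) \sum_(v : k.-tuple bool)
     b k j * (\1_(cube (center k v) (rad k j)) x)%:E)%E.

Lemma dominator_measurable b : (forall k j, 0 <= b k j)%E -> measurable_fun setT (dominator b).
Proof.
move=> b0; apply: ge0_emeasurable_sum => [k x _ _|k _].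
  by apply: sume_ge0 => j _; apply: sume_ge0 => v _; rewrite mule_ge0// lee_fin.
apply: emeasurable_sum => j; apply: emeasurable_sum => v.
apply: measurable_funeM; apply/measurable_EFinP; apply: measurable_indic.
exact: measurable_cube.
Qed.

Lemma dominator_integral b : (forall k j, 0 <= b k j)%E ->
  (\int[lam]_x dominator b x =
   \sum_(k <oo) \sum_(j < J k) (2 ^+ k * (2 * rad k j) ^+ n)%:E * b k j)%E.
Proof.
move=> b0; have [_ _ _ Hc] := Hlam.
have mterm k j (v : k.-tuple bool) : measurable_fun setT
    (fun x : Bn => b k j * (\1_(cube (center k v) (rad k j)) x)%:E)%E.
  apply: measurable_funeM; apply/measurable_EFinP; apply: measurable_indic.
  exact: measurable_cube.
rewrite integral_nneseries//; last 2 first.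
- by move=> k; apply: emeasurable_sum => j; apply: emeasurable_sum => v.
- by move=> k x _; apply: sume_ge0 => j _; apply: sume_ge0 => v _; rewrite mule_ge0// lee_fin.
apply: eq_eseriesr => k _; rewrite ge0_integral_sum//; last 2 first.
- by move=> j; apply: emeasurable_sum => v.
- by move=> j x _; apply: sume_ge0 => v _; rewrite mule_ge0// lee_fin.
apply: eq_bigr => j _; rewrite ge0_integral_sum//; last first.
  by move=> v x _; rewrite mule_ge0// lee_fin.
rewrite (eq_bigr (fun=> ((2 * rad k j) ^+ n)%:E * b k j)%E); last first.
  move=> v _; rewrite ge0_integralZl//; last first.
    by apply/measurable_EFinP; apply: measurable_indic; exact: measurable_cube.
  rewrite integral_indic//; last exact: measurable_cube.
  by rewrite setIT muleC [X in (X * _)%E](Hc _ _ (rad_gt0 R M k j)).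
rewrite -ge0_sume_distrl; last by move=> v _; rewrite lee_fin exprn_ge0// mulr_ge0// ltW// rad_gt0.
congr (_ * _)%E; rewrite sumEFin sumr_const card_tuple card_bool.
by rewrite -(mulr_natl (_ ^+ n)) natrX.
Qed.

Lemma dominator_ge b k j (v : k.-tuple bool) x : (forall k j, 0 <= b k j)%E ->
  (j < J k)%N -> cube (center k v) (rad k j) x -> (b k j <= dominator b x)%E.
Proof.
move=> b0 jJ xc.
have nn k' : (0 <= \sum_(j < J k') \sum_(v : k'.-tuple bool)
     b k' j * (\1_(cube (center k' v) (rad k' j)) x)%:E)%E.
  by apply: sume_ge0 => j' _; apply: sume_ge0 => v' _; rewrite mule_ge0// lee_fin.
apply: (@le_trans _ _ (\sum_(j < J k) \sum_(v : k.-tuple bool)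
     b k j * (\1_(cube (center k v) (rad k j)) x)%:E)%E); last first.
  apply: le_trans (nneseries_lim_ge k.+1 (fun l _ _ => nn l)).
  by rewrite big_nat_recr//= leeDr//; apply: sume_ge0 => l _; exact: nn.
rewrite (bigD1 (Ordinal jJ))//= (bigD1 v)//= indicE mem_set// mule1 -addeA leeDl//.
apply: adde_ge0; first by apply: sume_ge0 => v' _; rewrite mule_ge0// lee_fin.
by apply: sume_ge0 => j' _; apply: sume_ge0 => v' _; rewrite mule_ge0// lee_fin.
Qed.

(** Used with the absolute value of an entry for the integrability of the gradient, and with [A] of
    the Frobenius norm for the energy. *)
Lemma grad_dominated (b : nat -> nat -> \bar R) (f : 'rV[R]_n -> \bar R) x :
  (forall k j, 0 <= b k j)%E ->
  ((forall i m, grad x i m = 0) -> (f x <= 0)%E) ->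
  (forall k j, (forall i m, `|grad x i m| <= esize k j) -> (f x <= b k j)%E) ->
  (f x <= dominator b x)%E.
Proof.
move=> b0 f0 fb; have [H|[k [j [v [jJ a H]]]]] := gpart_cases x.
  apply: (@le_trans _ _ 0%E).
    by apply: f0 => i m; have [] := H i m 0%N.
  apply: nneseries_ge0 => k _ _; apply: sume_ge0 => j _; apply: sume_ge0 => v _.
  by rewrite mule_ge0// lee_fin.
apply: (@le_trans _ _ (b k j)); first by apply: fb => i m; case: (H i m).
by case: a => xc _; exact: (@dominator_ge b k j v).
Qed.

End WithMeasure.
End SobolevMap.

(** * Membership in the Orlicz-Sobolev class *)

Section Young.
Variables (R : realType) (A : R -> \bar R).
Hypothesis yA : young A.

Lemma young_ge0 t : 0 <= t -> (0 <= A t)%E.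
Proof. by case: yA => _ [] A0 _; exact: A0. Qed.

(** Convexity between 0 and [t], with [A 0 = 0]. This is what turns a finite energy into a finite
    Luxemburg norm. *)
Lemma young_contract l t : 0 <= l <= 1 -> 0 <= t -> (A (l * t) <= l%:E * A t)%E.
Proof.
move=> l01 t0; have [A0 [_ [cA _]]] := yA.
by have := cA t 0 l t0 (lexx 0) l01; rewrite mulr0 addr0 A0 mule0 adde0.
Qed.

Lemma young_mono r t : 0 <= r -> r <= t -> (A r <= A t)%E.
Proof.
move=> r0 rt; have [t0|t0] := eqVneq t 0.
  by have -> // : r = t by apply/eqP; rewrite eq_le rt t0 r0.
have tp : 0 < t by rewrite lt_def t0 (le_trans r0).
have l01 : 0 <= r / t <= 1 by rewrite divr_ge0 ?(ltW tp)//= ler_pdivrMr// mul1r.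
have := young_contract l01 (ltW tp); rewrite divfK// => /le_trans; apply.
rewrite -[leRHS]mul1e; apply: lee_wpmul2r; first exact: young_ge0 (ltW tp).
by rewrite lee_fin; case/andP: l01.
Qed.

End Young.

Section Frobenius.
Variables (R : realType) (n : nat).

Lemma frob_norm_le (G : 'M[R]_n) e : 0 <= e -> (forall i m, `|G i m| <= e) ->
  frob_norm G <= n%:R * e.
Proof.
move=> e0 H; rewrite /frob_norm -[leRHS]ger0_norm ?mulr_ge0// -sqrtr_sqr.
rewrite ler_sqrt; last exact: sqr_ge0.
apply: (@le_trans _ _ (\sum_(i < n) \sum_(m < n) e ^+ 2)).
  apply: ler_sum => i _; apply: ler_sum => m _.
  by rewrite -real_normK ?num_real// lerXn2r ?nnegrE.
by rewrite !sumr_const card_ord -mulrnA -(mulr_natl (_ ^+ 2)) natrM exprMn -expr2.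
Qed.

Lemma frob_norm_ge0 (G : 'M[R]_n) : 0 <= frob_norm G.
Proof. exact: sqrtr_ge0. Qed.

End Frobenius.

Section Membership.
Variables (R : realType) (p : nat).
Local Notation n := p.+1.
Local Notation Bn := (Bn R n).

Lemma int_Rn_le (f g : 'rV[R]_n -> \bar R) : (forall x, 0 <= f x)%E ->
  (forall x, f x <= g x)%E -> (int_Rn f <= int_Rn g)%E.
Proof. by move=> f0 fg; apply: iter_int_le => s. Qed.

Lemma borel_funP (f : 'rV[R]_n -> R) : measurable_fun setT (f : Bn -> R) -> borel_fun f.
Proof. by move=> mf B mB; have := mf measurableT B mB; rewrite setTI. Qed.

Variable lam : {measure set Bn -> \bar R}.
Hypothesis Hlam : lebesgue_Rn lam.

Lemma loc_integrableP (f : 'rV[R]_n -> R) :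
  lam.-integrable setT (fun x : Bn => (f x)%:E) -> loc_integrable f.
Proof.
move=> intf; have mf : measurable_fun setT (f : Bn -> R).
  by apply/measurable_EFinP; exact: measurable_int intf.
split=> [|K _]; first exact: borel_funP.
have [posE _ _ _] := Hlam.
apply: (@le_lt_trans _ _ (int_Rn (fun x => (`|f x|)%:E))).
  apply: int_Rn_le => x; rewrite lee_fin indicE; case: (_ \in _);
    by rewrite ?mul1r ?mul0r ?normr_ge0.
rewrite (posE (fun x => (`|f x|)%:E)).
- by move/integrableP : intf => [_].
- by move=> x; rewrite lee_fin.
- by apply/measurable_EFinP; exact: measurableT_comp.
Qed.

Lemma test_fun_C1 (psi : 'rV[R]_n -> R) m : test_fun psi -> C1_along m psi.
Proof.
move=> [smooth _]; have [dpsi cD] := smooth 1%N.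
split; [|exact: (smooth 0%N)|exact: cD].
by move=> x; apply: diff_derivable; exact: dpsi.
Qed.

Variables (J M : nat -> nat).
Hypothesis J_gt0 : forall k, (0 < J k)%N.
Hypothesis M_succ : forall k, M k.+1 = (M k + J k + 3)%N.
Variables (s : nat -> R) (t : R).
Hypothesis s_gt0 : forall k, 0 < s k.
Hypothesis t_lt : t < 1 / 2.
Hypothesis s_decr : forall k, s (k + n)%N <= t * s k.

Local Notation esize := (esize J M s).
Local Notation umap := (@umap R p J M s).
Local Notation grad := (@grad R p J M s).
Local Notation weight k j := (2 ^+ k * (2 * rad R M k j) ^+ n).

Hypothesis esize_summable :
  (\sum_(k <oo) \sum_(j < J k) (weight k j)%:E * (esize k j)%:E < +oo)%E.

Lemma grad_integrable i m : lam.-integrable setT (fun x : Bn => (grad x i m)%:E).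
Proof.
have mg := grad_measurable J_gt0 M_succ s_gt0 i m.
have b0 k j : (0 <= (esize k j)%:E)%E.
  by rewrite lee_fin ltW// esize_gt0.
apply/integrableP; split; first exact/measurable_EFinP.
apply: (@le_lt_trans _ _ (\int[lam]_x dominator J M (fun k j => (esize k j)%:E) x)%E).
  apply: ge0_le_integral_any => // x.
  apply: (grad_dominated J_gt0 M_succ s_gt0 (b := fun k j => (esize k j)%:E)
    (f := fun x => (`|grad x i m|)%:E)) => //.
    by move=> H; rewrite H normr0.
  by move=> k j H; rewrite lee_fin.
by rewrite dominator_integral.
Qed.

Lemma umap_integrable i : lam.-integrable setT (fun x : Bn => (umap x ord0 i)%:E).
Proof.
apply: (integrable_cube Hlam (c := 0) (r := 2) (K := s i / (1 - t))) => //.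
- by apply: continuous_measurable_Bn; exact: (umap_coord_continuous J_gt0 M_succ s_gt0 t_lt s_decr).
- move=> x; rewrite ger0_norm.
    have := umap_dist J_gt0 M_succ s_gt0 t_lt s_decr i 0 x.
    by rewrite /upart big_geq// subr0 /strided mul0n add0n.
  apply: le_trans (upart_le J_gt0 M_succ s_gt0 t_lt s_decr i 0 x).
  by rewrite /upart big_geq.
- by move=> x xc; apply: umap_support.
Qed.

(** The partial sums are finite combinations of bumps. They increase to [umap], and their gradients
    are bounded by [|grad|], so the limits themselves serve as majorants. *)
Lemma umap_ibp i m : ibp lam m (fun x => umap x ord0 i) (fun x => grad x i m).
Proof.
have iu := umap_integrable i; have ig := grad_integrable i m.
apply: (ibp_lim (f := upart J M s i) (g := gpart J M s i m)
  (F := fun x => umap x ord0 i) (G := fun x => `|grad x i m|) (c := 0) (r := 2)) => //.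
- move=> N; apply: ibp_sum => r _; apply: ibpZ; apply: ibpZ.
  apply: ibp_sum => j _; apply: ibp_sum => v _.
  by apply: ibp_bump => //; exact: rad_gt0.
- by move=> N; apply: continuous_measurable_Bn; exact: upart_continuous.
- by move=> N; apply: continuous_measurable_Bn; exact: gpart_continuous.
- by move=> x; exact: (upart_cvg J_gt0 M_succ s_gt0 t_lt s_decr).
- by move=> x; exact: (gpart_cvg J_gt0 M_succ s_gt0).
- move=> N x; rewrite ger0_norm ?upart_ge0//.
  exact: (upart_le J_gt0 M_succ s_gt0 t_lt s_decr).
- by move=> N x; exact: (gpart_le J_gt0 M_succ s_gt0).
- have := integrable_abse ig; congr (lam.-integrable _ _).
- by move=> x xc; apply: umap_support.
- by move=> x xc; rewrite (grad_support J_gt0 M_succ s_gt0)// normr0.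
Qed.

Lemma umap_weak_gradient : weak_gradient umap grad.
Proof.
split; first by move=> i; apply: loc_integrableP; exact: umap_integrable.
split; first by move=> i m; apply: loc_integrableP; exact: grad_integrable.
move=> psi tpsi i m; have [_ intE _ _] := Hlam.
have [i1 i2 e] := umap_ibp i (test_fun_C1 m tpsi).
by rewrite (intE _ i1) (intE _ i2).
Qed.

Variable A : R -> \bar R.
Hypothesis yA : young A.
Hypothesis energy_finite :
  (\sum_(k <oo) \sum_(j < J k) (weight k j)%:E * A (n%:R * esize k j) < +oo)%E.

Lemma grad_in_orlicz : in_orlicz A (fun x => frob_norm (grad x)).
Proof.
have [posE _ _ _] := Hlam.
split.
  apply: borel_funP.
  apply: (@measurableT_comp _ _ _ Bn _ _ (@Num.sqrt R) setT
    (fun x => \sum_(i < n) \sum_(m < n) grad x i m ^+ 2)).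
    by apply: continuous_measurable_fun; exact: sqrt_continuous.
  apply: measurable_sum => i; apply: measurable_sum => m.
  by apply: measurable_funX; exact: (grad_measurable J_gt0 M_succ s_gt0).
pose b k j := A (n%:R * esize k j).
pose S := (\sum_(k <oo) \sum_(j < J k) (weight k j)%:E * b k j)%E.
have Soo : (S < +oo)%E by exact: energy_finite.
have b0 k j : (0 <= b k j)%E.
  by apply: (young_ge0 yA); rewrite mulr_ge0// ltW// esize_gt0.
have S0 : (0 <= S)%E.
  apply: nneseries_ge0 => k _ _; apply: sume_ge0 => j _; apply: mule_ge0; last exact: b0.
  by rewrite lee_fin mulr_ge0 ?exprn_ge0// mulr_ge0// ltW// rad_gt0.
have Sfin : S \is a fin_num by rewrite ge0_fin_numE.
(* By convexity [A (x / L) <= A x / L], so an energy of at most [S] becomes at most [S / L <= 1]. *)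
pose L := 1 + fine S.
have L1 : 1 <= L by rewrite lerDl fine_ge0.
have L0 : 0 < L by lra.
exists L; split => //.
(* The comparison is made on iterated integrals; only the dominator, known to be measurable, is
   integrated against [lam]. *)
apply: (@le_trans _ _ (int_Rn (fun x => (L^-1)%:E * dominator J M b x)%E)).
  apply: int_Rn_le => x.
    by apply: (young_ge0 yA); rewrite divr_ge0// ltW.
  rewrite ger0_norm ?frob_norm_ge0// mulrC.
  apply: (le_trans (young_contract yA _ (frob_norm_ge0 _))).
    by rewrite invr_ge0 ltW//= invf_le1.
  apply: lee_wpmul2l; first by rewrite lee_fin invr_ge0 ltW.
  apply: (grad_dominated J_gt0 M_succ s_gt0 (b := b) (f := fun x => A (frob_norm (grad x)))) => //.
    move=> H; have -> : frob_norm (grad x) = 0.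
      rewrite /frob_norm big1 ?sqrtr0// => i _; rewrite big1// => m _.
      by rewrite H expr0n.
    by case: yA => ->.
  move=> k j H; apply: (young_mono yA); first exact: frob_norm_ge0.
  by apply: frob_norm_le => //; rewrite ltW// esize_gt0.
have mD : measurable_fun setT (@dominator R p J M b) by exact: dominator_measurable.
have D0 (x : Bn) : (0 <= dominator J M b x)%E.
  apply: nneseries_ge0 => k _ _; apply: sume_ge0 => j _; apply: sume_ge0 => v _.
  by rewrite mule_ge0// lee_fin.
have Li0 : 0 <= L^-1 by rewrite invr_ge0 ltW.
rewrite (posE (fun x => (L^-1)%:E * dominator J M b x)%E); last 2 first.
- by move=> x; rewrite mule_ge0.
- exact: measurable_funeM.
rewrite ge0_integralZl_EFin// dominator_integral// -/S.
rewrite -(fineK Sfin) -EFinM lee_fin mulrC ler_pdivrMr// mul1r /L; lra.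
Qed.

Lemma umap_V1A : V1A A umap.
Proof.
split; first exact: (umap_continuous J_gt0 M_succ s_gt0 t_lt s_decr).
by exists grad; split; [exact: umap_weak_gradient|exact: grad_in_orlicz].
Qed.

End Membership.

(** * Choice of the scales *)

Section Scales.
Variables (R : realType) (b : R).
Hypothesis b_gt0 : 0 < b.

(** With [b = - beta], the power [- b] of [rho ^+ k] is [2 ^- k], the mass of a piece of generation
    [k]. *)
Definition rho : R := 2 `^ b^-1.

Definition Jseq (k : nat) : nat := (Num.truncn (rho ^+ k)).+1.

Fixpoint Mseq (k : nat) : nat :=
  if k is k'.+1 then (Mseq k' + Jseq k' + 3)%N else 0%N.

Lemma rho_gt1 : 1 < rho.
Proof.
have -> : 1 = 1 `^ b^-1 :> R by rewrite powR1.
by rewrite /rho gt0_ltr_powR ?invr_gt0// ?nnegrE// ltr1n.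
Qed.

Lemma rho_gt0 : 0 < rho. Proof. exact: lt_trans ltr01 rho_gt1. Qed.

Lemma rhoX_ge1 k : 1 <= rho ^+ k.
Proof. by rewrite exprn_ege1// ltW// rho_gt1. Qed.

Lemma rhoX_powR k x : (rho ^+ k) `^ x = 2 `^ (k%:R * x / b).
Proof.
rewrite -powR_mulrn ?ltW ?rho_gt0// /rho -!powRrM; congr (_ `^ _); ring.
Qed.

Lemma Jseq_gt0 k : (0 < Jseq k)%N. Proof. by []. Qed.

Lemma Mseq_succ k : Mseq k.+1 = (Mseq k + Jseq k + 3)%N. Proof. by []. Qed.

Lemma Jseq_ge k : rho ^+ k <= (Jseq k)%:R.
Proof. by apply/ltW/truncnS_gt. Qed.

Lemma Jseq_le k : (Jseq k)%:R <= rho ^+ k + 1.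
Proof.
rewrite /Jseq -natr1 lerD2r truncn_le//.
by apply: le_trans (rhoX_ge1 k).
Qed.

(** The unit to spare absorbs the factor 2 in the diameter bound of the covering pieces. *)
Lemma Mseq_lower k : rho ^+ k <= (Mseq k.+1)%:R - 1.
Proof.
rewrite Mseq_succ !natrD; have := Jseq_ge k; have : 0 <= (Mseq k)%:R :> R by [].
by lra.
Qed.

(** [D] solves [D * rho = D + 5], and the increment [Jseq k + 3] is at most
    [rho ^+ k + 4 <= 5 * rho ^+ k], so the bound by [D * rho ^+ k] is inductive. *)
Lemma Mseq_upper : exists2 C : R, 0 < C & forall k, (Mseq k)%:R + 2 <= C * rho ^+ k.
Proof.
have r1 : 0 < rho - 1 by rewrite subr_gt0 rho_gt1.
pose D := 5 / (rho - 1).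
have D0 : 0 < D by rewrite divr_gt0.
have DE : D * rho = D + 5 by rewrite /D; field; rewrite gt_eqF.
exists (D + 2); first by rewrite addr_gt0.
have H k : (Mseq k)%:R <= D * rho ^+ k.
  elim: k => [|k IH]; first by rewrite expr0 mulr1 ltW.
  rewrite Mseq_succ !natrD exprSr mulrA [_ * _ * rho]mulrAC DE.
  by have := Jseq_le k; have := rhoX_ge1 k; lra.
by move=> k; rewrite mulrDl lerD// ler_peMr// rhoX_ge1.
Qed.

End Scales.

Section InverseSquares.
Variable R : realType.

Lemma sum_inv_squares N : \sum_(0 <= k < N) (k.+1%:R ^- 2 : R) <= 2.
Proof.
have H m : \sum_(0 <= k < m.+1) (k.+1%:R ^- 2 : R) <= 2 - m.+1%:R^-1.
  elim: m => [|m IH]; first by rewrite big_nat1 expr1n invr1; lra.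
  rewrite big_nat_recr//=; apply: (le_trans (lerD IH (lexx _))).
  rewrite -[m.+2%:R]natr1; have : 0 < m.+1%:R :> R by [].
  move: (m.+1%:R) => y y0; have y1 : 0 < y + 1 by lra.
  rewrite -subr_ge0.
  have -> : 2 - (y + 1)^-1 - (2 - y^-1 + (y + 1) ^- 2) = (y * (y + 1) ^+ 2)^-1.
    by field; rewrite !gt_eqF.
  by rewrite invr_ge0 mulr_ge0 ?(ltW y0)// exprn_ge0// ltW.
case: N => [|m]; first by rewrite big_geq.
by apply: le_trans (H m) _; rewrite lerBlDr lerDl invr_ge0.
Qed.

Lemma inv_square_summable (f : nat -> \bar R) (C : R) : 0 <= C ->
  (forall k, 0 <= f k)%E -> (forall k, f k <= (C * k.+1%:R ^- 2)%:E)%E ->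
  (\sum_(k <oo) f k < +oo)%E.
Proof.
move=> C0 f0 fC; apply: (@le_lt_trans _ _ (C * 2)%:E); last exact: ltry.
apply: lime_le; first exact: is_cvg_nneseries.
near=> N; apply: (@le_trans _ _ (\sum_(0 <= k < N) (C * k.+1%:R ^- 2)%:E)%E).
  by apply: lee_sum => k _.
by rewrite sumEFin lee_fin -mulr_sumr ler_wpM2l// sum_inv_squares.
Unshelve. all: by end_near. Qed.

End InverseSquares.

(** * The Cantor set and its Hausdorff measure *)

Section SourceSet.
Variables (R : realType) (p : nat).
Local Notation n := p.+1.
Variables (J M : nat -> nat).
Hypothesis J_gt0 : forall k, (0 < J k)%N.
Hypothesis M_succ : forall k, M k.+1 = (M k + J k + 3)%N.

Local Notation embed w := (@line R p (pos R M w)).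

Lemma edist_line (x y : R) : Defs.edist (@line R p x) (@line R p y) = `|x - y|.
Proof.
rewrite /Defs.edist (bigD1 ord0)//= big1 ?addr0 ?line_coord ?eqxx ?sqrtr_sqr//.
by move=> i /negbTE i0; rewrite !line_coord i0 subrr expr0n.
Qed.

Lemma index_le_M k : (4 * k <= M k)%N.
Proof. by elim: k => // k IH; rewrite M_succ; have := J_gt0 k; lia. Qed.

Lemma del_small e : 0 < e -> exists k, del R M k <= e.
Proof.
move=> e0; have := @cvg_expr R (2^-1); rewrite ger0_norm ?invr_ge0// invf_lt1// ltr1n => /(_ isT).
move=> /cvgrPdist_lt /(_ e e0) [k _ /(_ k (leqnn k))].
rewrite /= sub0r normrN ger0_norm ?exprn_ge0 ?invr_ge0// exprVn => h; exists k.
by apply: le_trans (ltW h); apply: pow2_le; have := index_le_M k; lia.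
Qed.

(** A continuous image of the Cantor space: words close to each other share their first [k] digits,
    so their points are close. *)
Lemma embed_compact : compact (range (fun w => embed w)).
Proof.
apply: (@continuous_compact cantor_space 'rV[R]_n (fun w => embed w) setT); last first.
  exact: cantor_space_compact.
apply: continuous_subspaceT => w; have FF := nbhs_filter w.
apply/(@cvg_ballP _ _ _ (nbhs w) FF) => e e0.
have [k ke] := del_small (e := e / 2) (divr_gt0 e0 (ltr0n _ 2)).
have : \forall w' \near w, forall l : 'I_k, (w : nat -> bool) l = (w' : nat -> bool) l.
  apply: (@filter_forall _ _ _ (nbhs w) FF) => l.
  have := @proj_continuous nat (fun=> bool) (nat_of_ord l) w [set w (nat_of_ord l)] (discrete_set1 _).
  by apply: (@filterS _ (nbhs w) FF) => w' /= H; exact/esym.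
apply: (@filterS _ (nbhs w) FF) => w' H; rewrite -cubeE// => i; rewrite !line_coord.
case: (i == ord0); last by rewrite subrr normr0.
have := @pos_close R J M J_gt0 M_succ w w' k (fun l lk => H (Ordinal lk)).
rewrite distrC; lra.
Qed.

End SourceSet.

Section PowerLemmas.
Variable R : realType.

Lemma powR_neg_anti (x y a : R) : 0 < x -> x <= y -> 0 <= a -> y `^ (- a) <= x `^ (- a).
Proof.
move=> x0 xy a0; have y0 := lt_le_trans x0 xy.
rewrite !powRN lef_pV2 ?posrE ?powR_gt0//.
by apply: ge0_ler_powR => //; rewrite nnegrE ltW.
Qed.

Lemma ln2_gt0 : 0 < ln (2 : R). Proof. by rewrite ln_gt0// ltr1n. Qed.

Lemma ln_pow2_inv m : ln (2 ^- m)^-1 = m%:R * ln 2 :> R.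
Proof. by rewrite invrK lnXn// mulr_natl. Qed.

Lemma rhoX_powR_neg (b : R) k : 0 < b -> (rho b ^+ k) `^ (- b) = 2 ^- k.
Proof.
move=> b0; rewrite (rhoX_powR b0) mulrN mulNr mulfK ?gt_eqF//.
by rewrite powRN powR_mulrn.
Qed.

End PowerLemmas.

Section SourceMeasure.
Variables (R : realType) (p : nat) (b : R) (varphi : R -> R) (c r0 : R).
Local Notation n := p.+1.
Hypotheses (b_gt0 : 0 < b) (gphi : gauge varphi) (c_gt0 : 0 < c) (r0_gt0 : 0 < r0).
Variables (J M : nat -> nat).
Hypothesis J_gt0 : forall k, (0 < J k)%N.
Hypothesis M_succ : forall k, M k.+1 = (M k + J k + 3)%N.
Hypothesis M_lower : forall k, rho b ^+ k <= (M k.+1)%:R - 1.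
Hypothesis M_upper : exists2 C : R, 0 < C & forall k, (M k)%:R + 2 <= C * rho b ^+ k.
Local Notation embed w := (@line R p (pos R M w)).

Lemma gauge_ge0 r : 0 <= r -> 0 <= varphi r.
Proof.
case: gphi => g0 [gp _]; rewrite le_eqVlt => /predU1P[<-|/gp /ltW//].
by rewrite g0.
Qed.

Lemma gauge_mono r s : 0 <= r -> r <= s -> varphi r <= varphi s.
Proof. by case: gphi => _ [_ [gm _]]; exact: gm. Qed.

(** Mass distribution with [theta = del / 2]: the logarithm of [1 / theta k] is [(M k + 1) * ln 2],
    at most [C * ln 2 * rho ^+ k], and its power [- b] is at least [2 ^- k] times the constant in
    [L]. *)
Lemma source_hausdorff_gt0 :
  (forall r, 0 < r < r0 -> c^-1 * (ln r^-1) `^ (- b) <= varphi r) ->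
  (0 < hausdorff varphi (range (fun w => embed w)))%E.
Proof.
move=> Hphi; have [C C0 HC] := M_upper.
have l2 := @ln2_gt0 R.
pose L := c^-1 * (C * ln 2) `^ (- b).
have L0 : 0 < L by rewrite mulr_gt0 ?invr_gt0// powR_gt0// mulr_gt0.
have [K HK] := del_small J_gt0 M_succ r0_gt0.
pose theta k := del R M k / 2.
have th0 k : 0 < theta k by rewrite divr_gt0// del_gt0.
apply: (@lt_le_trans _ _ L%:E); first by rewrite lte_fin.
apply: (le_trans _ (hausdorff_ge_pre _ _ (delta := theta K / 2) _)); last by rewrite divr_gt0.
apply: (hausdorff_pre_ge gauge_mono gauge_ge0 (theta := theta) (K := K)) => //.
- exact: ltW.
- by move=> k; rewrite /theta ler_pM2r ?invr_gt0//; apply: del_noninc (leqnSn k).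
- move=> e e0; have [k ke] := del_small J_gt0 M_succ e0; exists k.
  by rewrite /theta; have := del_gt0 R M k; lra.
- move=> w w' k l lk wl; rewrite edist_line.
  exact: (pos_sep R J_gt0 M_succ lk wl).
- move=> k Kk; apply: le_trans (Hphi (theta k) _); last first.
    rewrite th0/=; have := del_noninc R J_gt0 M_succ Kk; have := del_gt0 R M K.
    by rewrite /theta; lra.
  have -> : theta k = 2 ^- (M k + 1) by rewrite /theta /del pow2_add expr1.
  rewrite ln_pow2_inv /L -mulrA ler_pM2l ?invr_gt0//.
  rewrite -(rhoX_powR_neg k b_gt0) -powRM ?mulr_ge0 ?exprn_ge0 ?(ltW l2) ?(ltW C0) ?(ltW (rho_gt0 _))//.
  apply: powR_neg_anti; last exact: ltW.
    by rewrite mulr_gt0// ltr0n addn1.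
  rewrite mulrAC ler_pM2r// natrD; have := HC k; lra.
- by rewrite ltr_pdivrMr// ltr_pMr ?th0// ltr1n.
Qed.

(** Pieces of generation [k] have diameter at most [eta k = 2 * del k]. The asymptotics of [varphi]
    hold only below [r0]; the finitely many generations up to [K] are absorbed in [B']. *)
Lemma source_hausdorff_lty :
  (forall r, 0 < r < r0 -> varphi r <= c * (ln r^-1) `^ (- b)) ->
  (hausdorff varphi (range (fun w => embed w)) < +oo)%E.
Proof.
move=> Hphi; have l2 := @ln2_gt0 R.
have [K HK] := del_small J_gt0 M_succ (e := r0 / 4) (divr_gt0 r0_gt0 (ltr0n _ 4)).
pose eta k := 2 * del R M k.
have eta0 k : 0 < eta k by rewrite mulr_gt0// del_gt0.
pose B := c * ((rho b)^-1 * ln 2) `^ (- b).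
pose B' := \sum_(0 <= k < K.+1) 2 ^+ k * varphi (eta k).
have term0 k : 0 <= 2 ^+ k * varphi (eta k).
  by rewrite mulr_ge0 ?exprn_ge0// gauge_ge0// ltW.
have B0 : 0 <= B by rewrite mulr_ge0 ?(ltW c_gt0)// powR_ge0.
apply: (@le_lt_trans _ _ (B + B')%:E); last exact: ltry.
apply: (hausdorff_le gauge_mono gauge_ge0 (eta := eta)).
- by case: gphi.
- by move=> k; exact: ltW.
- move=> e e0; have [k ke] := del_small J_gt0 M_succ (e := e / 2) (divr_gt0 e0 (ltr0n _ 2)).
  by exists k; rewrite /eta; lra.
- move=> w w' k H; rewrite edist_line.
  by have := pos_close R J_gt0 M_succ H; have := del_gt0 R M k; rewrite /eta; lra.
- move=> k; have [kK|Kk] := leqP k K.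
    rewrite -[leLHS]add0r lerD// /B'.
    rewrite (bigD1_seq k) ?mem_index_iota ?iota_uniq//= lerDl.
    by apply: sumr_ge0 => i _.
  rewrite -[leLHS]addr0 lerD ?sumr_ge0//.
  case: k Kk => // k Kk.
  have ek : eta k.+1 = 2 ^- (M k.+1 - 1).
    rewrite /eta /del M_succ (_ : (M k + J k + 3 - 1)%N = (M k + J k + 2)%N); last by lia.
    by rewrite addnS exprS invfM mulrA divff ?mul1r.
  have M1 : (1 <= M k.+1)%N by rewrite M_succ; lia.
  apply: (@le_trans _ _ (2 ^+ k.+1 * (c * (ln (eta k.+1)^-1) `^ (- b)))).
    rewrite ler_pM2l ?exprn_gt0//; apply: Hphi; rewrite eta0/=.
    have := del_noninc R J_gt0 M_succ (ltnW Kk); have := del_gt0 R M K.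
    by rewrite /eta; move: (del R M k.+1) (del R M K) HK => x y; lra.
  rewrite ek ln_pow2_inv mulrCA /B ler_pM2l//.
  apply: (@le_trans _ _ (2 ^+ k.+1 * (2 ^- k.+1 * ((rho b)^-1 * ln 2) `^ (- b)))); last first.
    by rewrite mulrA divff ?mul1r// expf_neq0// pnatr_eq0.
  rewrite ler_pM2l ?exprn_gt0// -(rhoX_powR_neg k.+1 b_gt0).
  have rho0 := rho_gt0 b_gt0.
  rewrite -powRM ?mulr_ge0 ?exprn_ge0 ?invr_ge0 ?(ltW l2) ?(ltW rho0)//.
  rewrite mulrA exprSr mulfK ?gt_eqF//.
  apply: powR_neg_anti; last exact: ltW.
    by rewrite mulr_gt0 ?exprn_gt0.
  by rewrite ler_pM2r// natrB//; exact: M_lower.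
Qed.

End SourceMeasure.

(** * The amplitudes and the image of the Cantor set *)

Section TargetSequence.
Variables (R : realType) (sig : R).
Hypothesis sig_gt0 : 0 < sig.

Definition tau : R := 2 `^ (- sig^-1).
Definition sseq k : R := tau ^+ k * k.+1%:R `^ (- (1 + sig^-1)).

Lemma tau_gt0 : 0 < tau. Proof. exact: powR_gt0. Qed.

Lemma tauX k : tau ^+ k = 2 `^ (- (k%:R / sig)).
Proof.
rewrite -powR_mulrn ?ltW ?tau_gt0// /tau -powRrM; congr (_ `^ _); ring.
Qed.

Lemma tau_le1 : tau <= 1.
Proof. by rewrite -[leRHS](powRr0 2) ler_powR ?ler1n// oppr_le0 invr_ge0 ltW. Qed.

Lemma exponent_ge0 : 0 <= 1 + sig^-1. Proof. by rewrite addr_ge0// invr_ge0 ltW. Qed.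

Lemma sseq_gt0 k : 0 < sseq k.
Proof. by rewrite mulr_gt0 ?exprn_gt0 ?tau_gt0// powR_gt0. Qed.

Lemma sseq_factor_le1 k : k.+1%:R `^ (- (1 + sig^-1)) <= 1.
Proof.
by rewrite -[leRHS](powRr0 k.+1%:R) ler_powR ?ler1n// oppr_le0 exponent_ge0.
Qed.

Lemma sseq_le1 k : sseq k <= 1.
Proof.
rewrite -[leRHS]mulr1; apply: ler_pM.
- by rewrite exprn_ge0// ltW// tau_gt0.
- exact: powR_ge0.
- by apply: exprn_ile1; [exact: ltW tau_gt0|exact: tau_le1].
- exact: sseq_factor_le1.
Qed.

Lemma sseq_decr m k : sseq (k + m) <= tau ^+ m * sseq k.
Proof.
rewrite /sseq exprD [tau ^+ k * _]mulrC -!mulrA ler_pM2l ?exprn_gt0 ?tau_gt0//.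
rewrite ler_pM2l ?exprn_gt0 ?tau_gt0//.
by apply: powR_neg_anti; rewrite ?exponent_ge0// ler_nat; lia.
Qed.

Lemma sseq_noninc k l : (k <= l)%N -> sseq l <= sseq k.
Proof.
move=> kl; have := sseq_decr (l - k) k; rewrite subnKC// => /le_trans; apply.
apply: ler_piMl; first exact: ltW (sseq_gt0 _).
by apply: exprn_ile1; [exact: ltW tau_gt0|exact: tau_le1].
Qed.

Lemma tauX_lt m : sig < m%:R -> tau ^+ m < 1 / 2.
Proof.
move=> sm; rewrite tauX mul1r -[ltRHS]powR_inv1//.
rewrite !powRN ltf_pV2 ?posrE ?powR_gt0// powRr1//.
have m1 : 1 < m%:R / sig by rewrite ltr_pdivlMr// mul1r.
rewrite /powR !ifN_eq ?pnatr_eq0// -[X in X < _](@lnK _ 2) ?posrE// ltr_expR.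
by rewrite ltr_pMl// ln2_gt0.
Qed.

Lemma sseq_powR k : sseq k `^ sig = 2 ^- k * k.+1%:R `^ (- (sig + 1)).
Proof.
rewrite /sseq powRM ?exprn_ge0 ?(ltW tau_gt0) ?powR_ge0//; congr (_ * _).
  by rewrite tauX -powRrM mulNr divfK ?gt_eqF// powRN powR_mulrn.
rewrite -powRrM; congr (_ `^ _); field; rewrite gt_eqF//.
Qed.

(** The geometric factor alone gives [k / sig * ln 2]; [kap] and the polynomial factor are at most 1
    and only enlarge the logarithm. For [k > 0] one has [k >= (k + 1) / 2], whence the 2 in the
    denominator. *)
Lemma ln_sseq kap k : 0 < kap <= 1 -> (0 < k)%N ->
  k.+1%:R * (ln 2 / (2 * sig)) <= ln (kap * sseq k)^-1.
Proof.
move=> /andP[kap0 kap1] k0.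
have l2 := @ln2_gt0 R.
have h : tau ^- k <= (kap * sseq k)^-1.
  rewrite lef_pV2 ?posrE ?mulr_gt0 ?sseq_gt0 ?exprn_gt0 ?tau_gt0//.
  apply: (@le_trans _ _ (sseq k)); first by rewrite ler_piMl ?(ltW (sseq_gt0 _)).
  by rewrite ler_piMr ?sseq_factor_le1// exprn_ge0// ltW// tau_gt0.
apply: (@le_trans _ _ (ln (tau ^- k))); last first.
  by rewrite ler_ln ?posrE ?invr_gt0 ?mulr_gt0 ?sseq_gt0 ?exprn_gt0 ?tau_gt0.
rewrite tauX -powRN opprK ln_powR.
have -> : k.+1%:R * (ln 2 / (2 * sig)) = (k.+1%:R / 2) / sig * ln 2 by field; rewrite gt_eqF.
rewrite ler_pM2r// ler_pM2r ?invr_gt0// ler_pdivrMr//.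
by rewrite -natrM ler_nat; lia.
Qed.

End TargetSequence.

Section Target.
Variables (R : realType) (p : nat) (sig : R) (J M : nat -> nat).
Local Notation n := p.+1.
Hypothesis sig_gt0 : 0 < sig.
Hypothesis sig_lt : sig < n%:R.
Hypothesis J_gt0 : forall k, (0 < J k)%N.
Hypothesis M_succ : forall k, M k.+1 = (M k + J k + 3)%N.
Local Notation s := (sseq sig).
Local Notation t := (tau sig ^+ n).
Local Notation image w := (@umap R p J M s (line p (pos R M w))).

Lemma target_t_lt : t < 1 / 2. Proof. exact: tauX_lt. Qed.
Lemma target_s_decr k : s (k + n)%N <= t * s k. Proof. exact: sseq_decr. Qed.

(** The separation constant of [bsum_sep] for the ratio [t]. *)
Definition kappa : R := (1 - 2 * t) / (1 - t).

Lemma kappa_bounds : 0 < kappa <= 1.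
Proof.
have t0 : 0 < t by rewrite exprn_gt0// tau_gt0.
have t2 := target_t_lt; rewrite /kappa; move: t0 t2; move: (t) => y y0 y2.
have y1 : 0 < 1 - y by lra.
by rewrite divr_gt0//= ?ler_pdivrMr ?mul1r//; lra.
Qed.

(** Let [j] be the first place of difference. In coordinate [j %% n] the subsampled words first
    differ at index [j %/ n], whose amplitude is [s j >= s k]. *)
Lemma image_sep (w w' : nat -> bool) k l : (l <= k)%N -> w l != w' l ->
  kappa * s k <= Defs.edist (image w) (image w').
Proof.
move=> lk /first_difference [j jl [wj H]].
have nj : (j %% n < n)%N by rewrite ltn_mod.
pose i : 'I_n := Ordinal nj; pose r := (j %/ n)%N.
have jE : (r * n + i)%N = j by rewrite /= -divn_eq.
apply: le_trans (edist_ge_coord _ _ i); rewrite !umap_line//.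
have S := bsum_sep (strided_gt0 (sseq_gt0 sig) i) target_t_lt (strided_decr target_s_decr i)
  (w := fun r => w (r * n + i)%N) (w' := fun r => w' (r * n + i)%N) (l := r).
apply: le_trans (S _ _).
- rewrite /strided jE mulrC -/kappa ler_pM2r; last by case/andP: kappa_bounds.
  exact: sseq_noninc (leq_trans jl lk).
- move=> k' k'r; apply: H; rewrite -jE ltn_add2r ltn_pmul2r//.
- by rewrite jE.
Qed.

Lemma target_hausdorff (phi : R -> R) (c r0 mu : R) : gauge phi -> 0 < c -> 0 < r0 ->
  (forall r, 0 < r < r0 -> c^-1 * (r `^ sig * (ln r^-1) `^ mu) <= phi r) ->
  1 + sig < mu -> hausdorff phi (range (fun w => image w)) = +oo%E.
Proof.
move=> gphi c0 r00 Hphi mu_gt; apply/eqyP => L L0.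
have /andP[k0 k1] := kappa_bounds.
pose theta k := kappa * s k.
have th0 k : 0 < theta k by rewrite mulr_gt0// sseq_gt0.
have thlim e : 0 < e -> exists k, theta k <= e.
  move=> e0; have := @cvg_expr R (tau sig).
  rewrite gtr0_norm ?tau_gt0// => /(_ _)/cvgrPdist_lt.
  have t1 : tau sig < 1.
    by have := @tauX_lt R sig sig_gt0 n sig_lt; apply: contraTT; rewrite -!leNgt => h;
      apply: (@le_trans _ _ 1); [lra|exact: exprn_ege1].
  move=> /(_ t1 e e0) [k _ /(_ k (leqnn k))].
  rewrite /= sub0r normrN ger0_norm ?exprn_ge0 ?(ltW (tau_gt0 _))// => h; exists k.
  apply: le_trans (ltW h); apply: (@le_trans _ _ (s k)).
    by rewrite ler_piMl// ltW// sseq_gt0.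
  by rewrite ler_piMr ?sseq_factor_le1// exprn_ge0// ltW// tau_gt0.
have thS k l : (k <= l)%N -> theta l <= theta k.
  by move=> kl; rewrite ler_pM2l// sseq_noninc.
pose c2 := ln 2 / (2 * sig).
have c20 : 0 < c2 by rewrite divr_gt0 ?ln2_gt0// mulr_gt0.
pose D := c^-1 * kappa `^ sig * c2 `^ mu.
have D0 : 0 < D by rewrite !mulr_gt0 ?invr_gt0// powR_gt0.
pose e := mu - (sig + 1).
have e0 : 0 < e by rewrite subr_gt0 addrC.
have mu0 : 0 <= mu by move: sig_gt0 mu_gt; lra.
have [K1 HK1] : exists K1 : nat, (L / D) `^ e^-1 <= K1%:R.
  by exists (Num.truncn ((L / D) `^ e^-1)).+1; exact/ltW/truncnS_gt.
have [K2 HK2] := thlim (r0 / 2) (divr_gt0 r00 (ltr0n _ 2)).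
(* From [K1] on, [D * (k + 1) ^ e >= L]; from [K2] on, [theta] is below [r0]; and [ln_sseq] asks for
   [k > 0]. *)
pose K := maxn K1 (maxn K2 1).
apply: (le_trans _ (hausdorff_ge_pre _ _ (delta := theta K / 2) _)); last by rewrite divr_gt0.
apply: (hausdorff_pre_ge (gauge_mono gphi) (gauge_ge0 gphi) (theta := theta) (K := K)) => //.
- exact: ltW.
- by move=> k; exact: thS.
- by move=> w w' k l lk wl; exact: image_sep wl.
- move=> k; rewrite !geq_max => /and3P[K1k K2k kpos].
  apply: le_trans (Hphi (theta k) _); last by rewrite th0/=; have := thS _ _ K2k; lra.
  rewrite powRM ?(ltW k0)//; last exact/ltW/sseq_gt0.
  rewrite sseq_powR//.
  have lnb : (k.+1%:R * c2) `^ mu <= ln (theta k)^-1 `^ mu.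
    have h : k.+1%:R * c2 <= ln (theta k)^-1 by apply: ln_sseq => //; exact/andP.
    have h0 : 0 <= k.+1%:R * c2 by rewrite mulr_ge0// (ltW c20).
    by apply: ge0_ler_powR; rewrite // nnegrE// (le_trans h0).
  apply: (@le_trans _ _ (c^-1 * (kappa `^ sig * (2 ^- k * k.+1%:R `^ (- (sig + 1))) * (k.+1%:R * c2) `^ mu))); last first.
    rewrite ler_pM2l ?invr_gt0// ler_pM2l//.
    by rewrite !mulr_gt0 ?powR_gt0// invr_gt0 exprn_gt0.
  rewrite powRM ?(ltW c20)//.
  have -> : c^-1 * (kappa `^ sig * (2 ^- k * k.+1%:R `^ (- (sig + 1))) * (k.+1%:R `^ mu * c2 `^ mu))
    = D * (k.+1%:R `^ mu * k.+1%:R `^ (- (sig + 1))) * 2 ^- k by rewrite /D; ring.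
  rewrite ler_pM2r ?invr_gt0 ?exprn_gt0// -powRD; last by rewrite pnatr_eq0 implybT.
  rewrite -/e mulrC -ler_pdivrMr//.
  have -> : L / D = ((L / D) `^ e^-1) `^ e.
    by rewrite -powRrM mulVf ?gt_eqF// powRr1// ltW// divr_gt0.
  apply: ge0_ler_powR; rewrite ?nnegrE ?powR_ge0 ?(ltW e0)//.
  by apply: (le_trans HK1); rewrite ler_nat; exact: leqW K1k.
- by rewrite ltr_pdivrMr// ltr_pMr// ltr1n.
Qed.

End Target.

(** * The energy estimate *)

Section YoungGrowth.
Variables (R : realType) (A : R -> \bar R) (n : nat) (q : R).

(* Below the range of the asymptotics, convexity bounds A by a linear function. *)
Lemma young_growth : young A -> 0 <= q ->
  esim_near_infty A (fun t => t ^+ n * (ln t) `^ q) ->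
  exists C1 C2 : R, [/\ 0 <= C1, 0 <= C2 &
    forall y X, 0 <= y -> 0 <= X -> (1 <= y -> ln y <= X) ->
      (A y <= (C1 * y + C2 * (y ^+ n * X `^ q))%:E)%E].
Proof.
move=> yA q0 [c [t0 [c0 H]]].
(* A point in the range of the asymptotics, so that [A t1] is finite, and above 1, so that
   logarithms beyond it are nonnegative. *)
pose t1 : R := Num.max t0 1 + 1.
have t1_gt0 : t0 < t1 by rewrite /t1 (le_lt_trans (y := Num.max t0 1))// ?le_max ?lexx// ltrDl.
have t1_gt1 : 1 < t1 by rewrite /t1 (le_lt_trans (y := Num.max t0 1))// ?le_max ?lexx ?orbT// ltrDl.
have t1p : 0 < t1 by lra.
have At1 : A t1 \is a fin_num.
  rewrite ge0_fin_numE; last by apply: (young_ge0 yA); exact: ltW.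
  by apply: le_lt_trans (proj2 (H t1 t1_gt0)) _; exact: ltry.
have At1p : 0 <= fine (A t1) by rewrite fine_ge0// (young_ge0 yA)// ltW.
exists (fine (A t1) / t1), c; split; first by rewrite divr_ge0// ltW.
  exact: ltW.
(* [X] stands for any upper bound of [ln y]: the energy estimate uses one bound for a whole
   generation. *)
move=> y X y0 X0 HX; have [yt|ty] := lerP y t1.
  have l01 : 0 <= y / t1 <= 1 by rewrite divr_ge0 ?(ltW t1p)//= ler_pdivrMr// mul1r.
  have := young_contract yA l01 (ltW t1p); rewrite divfK ?gt_eqF// => /le_trans; apply.
  rewrite -(fineK At1) -EFinM lee_fin.
  have -> : y / t1 * fine (A t1) = fine (A t1) / t1 * y by ring.
  by rewrite lerDl mulr_ge0 ?(ltW c0)// mulr_ge0 ?exprn_ge0// powR_ge0.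
apply: le_trans (proj2 (H y (lt_trans t1_gt0 ty))) _.
rewrite lee_fin -[leLHS]add0r lerD//.
  by rewrite mulr_ge0// divr_ge0// ltW.
rewrite ler_pM2l// ler_wpM2l ?exprn_ge0//.
have y1 : 1 <= y by rewrite ltW// (lt_trans t1_gt1).
by apply: ge0_ler_powR; rewrite ?nnegrE ?ln_ge0// HX.
Qed.

End YoungGrowth.

Section Energy.
Variables (R : realType) (p : nat) (sig b q : R) (J M : nat -> nat).
Local Notation n := p.+1.
Hypothesis sig_gt0 : 0 < sig.
Hypothesis b_gt0 : 0 < b.
Hypothesis q_gt : p%:R < q.
Hypothesis sigE : n%:R / sig = 1 + (q - p%:R) / b.
Hypothesis J_gt0 : forall k, (0 < J k)%N.
Hypothesis J_ge : forall k, rho b ^+ k <= (J k)%:R.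
Hypothesis M_succ : forall k, M k.+1 = (M k + J k + 3)%N.
Hypothesis M_upper : exists2 C : R, 0 < C & forall k, (M k)%:R + 2 <= C * rho b ^+ k.
Local Notation s := (sseq sig).
Local Notation rad := (rad R M).
Local Notation esize := (esize J M s).
Local Notation weight k j := (2 ^+ k * (2 * rad k j) ^+ n).
Local Notation r k := (rho b ^+ k).

Let r_gt0 k : 0 < r k. Proof. by rewrite exprn_gt0// rho_gt0. Qed.

(** The exponent of 2 is [k * (1 - n / sig + (q - p) / b)], zero by [sigE]; this is the equation
    that determines [sigma]. What remains is [k + 1] to the power [- (n + n / sig)], which is at
    most [-2]. *)
Lemma scale_balance k : 2 ^+ k * s k ^+ n * r k `^ (q - p%:R) <= k.+1%:R ^- 2.
Proof.
have k1 : 1 <= k.+1%:R :> R by rewrite ler1n.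
have E : 2 ^+ k * s k ^+ n * r k `^ (q - p%:R) = k.+1%:R `^ (- (1 + sig^-1) * n%:R).
  rewrite /sseq exprMn -[(k.+1%:R `^ _) ^+ n]powR_mulrn ?powR_ge0// -powRrM.
  rewrite mulrA mulrAC -[RHS]mul1r; congr (_ * _).
  rewrite -exprM tauX (rhoX_powR b_gt0) -powR_mulrn// -!powRD ?pnatr_eq0 ?implybT//.
  rewrite -[RHS](powRr0 2); congr (_ `^ _).
  rewrite natrM -mulrA sigE; ring.
rewrite E -powR_mulrn// -powRN ler_powR// mulNr lerN2.
have sn : 1 <= n%:R / sig.
  by rewrite sigE lerDl divr_ge0 ?(ltW b_gt0)// subr_ge0 ltW.
rewrite mulrDl mul1r [sig^-1 * _]mulrC.
have : 1 <= n%:R :> R by rewrite ler1n.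
lra.
Qed.

(** Serves both the integrability of the gradient and the linear part of [young_growth]. In
    dimension at least 2 the factor [rad ^+ p] beats [2 ^+ k]; in dimension 1 it is absent and
    [scale_balance] takes over. *)
Lemma linear_energy k :
  \sum_(j < J k) weight k j * esize k j <= 2 ^+ n * 4 * k.+1%:R ^- 2.
Proof.
have Jk0 : 0 < (J k)%:R :> R by rewrite ltr0n.
have s0 := sseq_gt0 sig k.
have key : 2 ^+ k * s k * (2 ^- M k) ^+ p <= k.+1%:R ^- 2.
  have [p0|p0] := posnP p.
    rewrite p0 expr0 mulr1; apply: le_trans (scale_balance k).
    have -> : s k ^+ n = s k by rewrite p0 expr1.
    apply: ler_peMr; first by apply: mulr_ge0; [exact: exprn_ge0|exact: ltW].
    apply: (@le_trans _ _ (1 `^ (q - p%:R))); first by rewrite powR1.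
    have qp : 0 <= q - p%:R by rewrite subr_ge0 ltW.
    by apply: (ge0_ler_powR qp); rewrite ?nnegrE ?(ltW (r_gt0 k))// rhoX_ge1.
  have h1 : (2 ^- M k) ^+ p <= 2 ^- (4 * k) :> R.
    apply: (@le_trans _ _ (2 ^- M k)); last first.
      by apply: pow2_le; exact: (index_le_M J_gt0 M_succ).
    rewrite -[leRHS]expr1 ler_wiXn2l ?(ltW (pow2_gt0 _ _))//.
    by have := @pow2_le R _ _ (leq0n (M k)); rewrite expr0 invr1.
  apply: (@le_trans _ _ (2 ^+ k * 1 * 2 ^- (4 * k))).
    apply: ler_pM => //.
    - by apply: mulr_ge0; [exact: exprn_ge0|exact: ltW].
    - by rewrite ler_pM2l ?exprn_gt0// sseq_le1.
  rewrite mulr1 (_ : (4 * k = k + 3 * k)%N); last by lia.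
  rewrite pow2_add mulrA divff ?expf_neq0 ?pnatr_eq0// mul1r.
  rewrite lef_pV2 ?posrE ?exprn_gt0//.
  have h2 : k.+1%:R <= 2 ^+ k :> R by rewrite -natrX ler_nat ltn_expl.
  apply: (@le_trans _ _ ((2 ^+ k) ^+ 2)); first by rewrite lerXn2r ?nnegrE ?exprn_ge0.
  by rewrite -exprM ler_weXn2l ?ler1n//; lia.
apply: (@le_trans _ _ (\sum_(j < J k) (J k)%:R^-1 * (2 ^+ n * 4 * k.+1%:R ^- 2))); last first.
  by rewrite sumr_const card_ord -mulrnAl -[_^-1 *+ _]mulr_natl divff ?gt_eqF// mul1r.
apply: ler_sum => j _; have rd0 := rad_gt0 R M k j.
have -> : weight k j * esize k j = (J k)%:R^-1 * (2 ^+ n * 4 * (2 ^+ k * s k * rad k j ^+ p)).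
  rewrite exprMn [rad k j ^+ n]exprS -[esize k j]/(4 * s k / ((J k)%:R * rad k j)).
  move: (2 ^+ n) (2 ^+ k) (rad k j ^+ p) (rad k j) rd0 => a c d e e0.
  by field; rewrite !gt_eqF.
rewrite ler_pM2l ?invr_gt0// ler_pM2l ?mulr_gt0 ?exprn_gt0//.
apply: le_trans key; rewrite ler_pM2l; last by apply: mulr_gt0; [exact: exprn_gt0|].
by rewrite lerXn2r ?nnegrE ?(ltW rd0) ?(ltW (pow2_gt0 _ _))//; apply: pow2_le; lia.
Qed.

(** [2 * rad k j * esize k j = 8 * s k / J k] is the same at all scales [j], so the sum only
    multiplies by [J k]. By [J_ge], dividing the logarithmic factor [r ^ q] by [J ^ p] leaves at
    most [r ^ (q - p)], as in [scale_balance]. *)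
Lemma power_energy k :
  \sum_(j < J k) weight k j * (esize k j ^+ n * r k `^ q) <= 8 ^+ n * k.+1%:R ^- 2.
Proof.
have Jk0 : 0 < (J k)%:R :> R by rewrite ltr0n.
have s0 := sseq_gt0 sig k; have rk0 := r_gt0 k.
have E (j : 'I_(J k)) : weight k j * (esize k j ^+ n * r k `^ q) =
    8 ^+ n * (2 ^+ k * s k ^+ n * r k `^ q / (J k)%:R ^+ n).
  have rd0 := rad_gt0 R M k j.
  have h : 2 * rad k j * esize k j = 8 * s k / (J k)%:R.
    by rewrite -[esize k j]/(4 * s k / ((J k)%:R * rad k j)); field; rewrite !gt_eqF.
  have -> : weight k j * (esize k j ^+ n * r k `^ q) =
      2 ^+ k * (2 * rad k j * esize k j) ^+ n * r k `^ q.
    by rewrite [(2 * rad k j * _) ^+ n]exprMn; ring.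
  by rewrite h expr_div_n exprMn; ring.
rewrite (eq_bigr _ (fun j _ => E j)) sumr_const card_ord -mulrnAr ler_pM2l ?exprn_gt0//.
apply: le_trans (scale_balance k).
have Jp0 : 0 < (J k)%:R ^+ p :> R by exact: exprn_gt0.
have JE : (J k)%:R ^+ n = (J k)%:R * (J k)%:R ^+ p :> R by rewrite exprS.
have -> : 2 ^+ k * s k ^+ n * r k `^ q / (J k)%:R ^+ n *+ J k =
    2 ^+ k * s k ^+ n * (r k `^ q / (J k)%:R ^+ p).
  rewrite -[LHS]mulr_natr JE; move: (s k ^+ n) (_ ^+ p) Jp0 => x y y0.
  by field; rewrite !gt_eqF.
rewrite ler_pM2l; last by apply: mulr_gt0; exact: exprn_gt0.
rewrite ler_pdivrMr//.
apply: (@le_trans _ _ (r k `^ (q - p%:R) * r k ^+ p)).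
  by rewrite -(powR_mulrn p (ltW rk0)) -powRD ?subrK// (gt_eqF rk0) implybT.
by rewrite ler_pM2l ?powR_gt0// lerXn2r ?nnegrE ?(ltW rk0) ?(ltW Jk0).
Qed.

Let esize_pos k j : 0 < esize k j.
Proof. by apply: esize_gt0 => // l; exact: sseq_gt0. Qed.

Let weight_ge0 k j : 0 <= weight k j.
Proof. by apply: mulr_ge0; [exact: exprn_ge0|rewrite exprn_ge0// mulr_ge0// ltW// rad_gt0]. Qed.

Lemma esize_summable :
  (\sum_(k <oo) \sum_(j < J k) (weight k j)%:E * (esize k j)%:E < +oo)%E.
Proof.
apply: (inv_square_summable (C := 2 ^+ n * 4)).
- by apply: mulr_ge0 => //; exact: exprn_ge0.
- move=> k; apply: sume_ge0 => j _; rewrite -EFinM lee_fin; apply: mulr_ge0; first exact: weight_ge0.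
  exact: ltW (esize_pos _ _).
- move=> k; under eq_bigr do rewrite -EFinM.
  by rewrite sumEFin lee_fin linear_energy.
Qed.

(** All radii of generation [k] exceed [2 ^- M k.+1], so the logarithm of the gradient is at most of
    order [M k.+1], that is of order [rho ^+ k]. *)
Lemma ln_esize_bound : exists2 C : R, 0 <= C & forall k j, (j < J k)%N ->
  1 <= n%:R * esize k j -> ln (n%:R * esize k j) <= C * r k.
Proof.
have [C C0 HC] := M_upper.
have l2 := @ln2_gt0 R.
have n1 : 1 <= 4 * n%:R :> R by rewrite -natrM ler1n.
exists (ln (4 * n%:R) + C * rho b * ln 2).
  by rewrite addr_ge0 ?ln_ge0// !mulr_ge0 ?(ltW l2) ?(ltW C0) ?(ltW (rho_gt0 b_gt0)).
move=> k j jJ y1; have rd0 := rad_gt0 R M k j.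
have Jk1 : 1 <= (J k)%:R :> R by rewrite ler1n.
have Jk0 : 0 < (J k)%:R :> R by rewrite ltr0n.
have yle : n%:R * esize k j <= 4 * n%:R * 2 ^+ M k.+1.
  rewrite -[esize k j]/(4 * s k / ((J k)%:R * rad k j)) (_ : n%:R * (4 * s k / ((J k)%:R * rad k j)) =
    4 * n%:R * (s k * (J k)%:R^-1 * (rad k j)^-1)); last by field; rewrite !gt_eqF.
  rewrite ler_pM2l ?mulr_gt0 ?ltr0n//.
  apply: (@le_trans _ _ (1 * (rad k j)^-1)).
    rewrite ler_pM2r ?invr_gt0// -[leRHS]mulr1.
    apply: ler_pM; [exact: ltW (sseq_gt0 _ _)|by rewrite invr_ge0 ltW|exact: sseq_le1|].
    by rewrite invf_le1.
  by rewrite mul1r -[rad k j]/(2 ^- (M k + 2 + j)) invrK ler_weXn2l ?ler1n// M_succ; lia.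
apply: (@le_trans _ _ (ln (4 * n%:R * 2 ^+ M k.+1))).
  have y0 : 0 < n%:R * esize k j by lra.
  by rewrite ler_ln ?posrE// (lt_le_trans y0 yle).
rewrite lnM ?posrE ?mulr_gt0 ?exprn_gt0 ?ltr0n// lnXn// -[ln 2 *+ _]mulr_natl [leRHS]mulrDl; apply: lerD.
  by rewrite ler_peMr ?ln_ge0// rhoX_ge1.
rewrite [leRHS]mulrAC ler_pM2r// -mulrA -exprS.
by have := HC k.+1; lra.
Qed.

Lemma energy_finite (A : R -> \bar R) : young A ->
  esim_near_infty A (fun t => t ^+ n * (ln t) `^ q) ->
  (\sum_(k <oo) \sum_(j < J k) (weight k j)%:E * A (n%:R * esize k j)%R < +oo)%E.
Proof.
move=> yA HA; have q0 : 0 <= q by rewrite (le_trans _ (ltW q_gt)).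
have [C1 [C2 [C10 C20 HC]]] := young_growth yA q0 HA.
have [C3 C30 HX] := ln_esize_bound.
pose D1 := C1 * n%:R; pose D2 := C2 * n%:R ^+ n * C3 `^ q.
have D10 : 0 <= D1 by rewrite mulr_ge0.
have D20 : 0 <= D2 by rewrite !mulr_ge0 ?exprn_ge0 ?powR_ge0.
apply: (inv_square_summable (C := D1 * (2 ^+ n * 4) + D2 * 8 ^+ n)).
- by apply: addr_ge0; apply: mulr_ge0.
- move=> k; apply: sume_ge0 => j _; apply: mule_ge0; first by rewrite lee_fin.
  by apply: (young_ge0 yA); apply: mulr_ge0 => //; exact: ltW (esize_pos _ _).
- move=> k.
  apply: (@le_trans _ _ (\sum_(j < J k) (D1 * (weight k j * esize k j) +
      D2 * (weight k j * (esize k j ^+ n * r k `^ q)))%R%:E)%E).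
    apply: lee_sum => j _.
    apply: (@le_trans _ _ ((weight k j)%:E * (C1 * (n%:R * esize k j) +
        C2 * ((n%:R * esize k j) ^+ n * (C3 * r k) `^ q))%R%:E)%E).
      apply: lee_wpmul2l; first by rewrite lee_fin.
      apply: HC; last exact: HX.
        by apply: mulr_ge0 => //; exact: ltW (esize_pos _ _).
      by apply: mulr_ge0 => //; exact: ltW (r_gt0 _).
    rewrite -EFinM lee_fin powRM ?(ltW (r_gt0 _))// [(n%:R * esize k j) ^+ n]exprMn /D1 /D2.
    move: (weight k j) (esize k j ^+ n) (n%:R ^+ n) (esize k j) (r k `^ q) => w e1 n1 e z.
    by rewrite le_eqVlt; apply/orP; left; apply/eqP; ring.
  rewrite sumEFin lee_fin.
  have -> : \sum_(j < J k) (D1 * (weight k j * esize k j) +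
      D2 * (weight k j * (esize k j ^+ n * r k `^ q))) =
    D1 * (\sum_(j < J k) weight k j * esize k j) +
    D2 * (\sum_(j < J k) weight k j * (esize k j ^+ n * r k `^ q)).
    by rewrite big_split/= !mulr_sumr.
  rewrite [leRHS]mulrDl; apply: lerD; rewrite -[leRHS]mulrA; apply: ler_wpM2l => //.
    exact: linear_energy.
  exact: power_energy.
Qed.

End Energy.

Unset Implicit Arguments.

Theorem theorem6p2 (R : realType) (n : nat) (A : R -> \bar R) (q : R)
    (varphi : R -> R) (beta : R) (mu : R) (phi : R -> R) :
  (0 < n)%N ->
  young A ->
  n%:R - 1 < q ->
  esim_near_infty A (fun t => t ^+ n * (ln t) `^ q) ->
  gauge varphi ->
  beta < 0 ->
  sim_near_zero varphi (fun r => (ln r^-1) `^ beta) ->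
  let sigma := n%:R * beta / (n%:R - q - 1 + beta) in
  1 + sigma < mu ->
  gauge phi ->
  sim_near_zero phi (fun r => r `^ sigma * (ln r^-1) `^ mu) ->
  exists (u : 'rV[R]_n -> 'rV[R]_n) (E : set 'rV[R]_n),
    V1A A u /\ compact E /\
    (0 < hausdorff varphi E)%E /\ (hausdorff varphi E < +oo)%E /\
    hausdorff phi (u @` E) = +oo%E.
Proof.
case: n => // p _ yA qn HA gvarphi beta0 [c [r0 [c0 [r00 Hvarphi]]]] sigma mu_gt gphi
  [c' [r0' [c0' [r00' Hphi]]]].
pose b := - beta.
have b0 : 0 < b by rewrite oppr_gt0.
have betaE : beta = - b by rewrite opprK.
have q_gt : p%:R < q by rewrite -natr1 in qn; lra.
have den0 : 0 < q - p%:R + b by lra.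
have sigmaE : sigma = p.+1%:R * b / (q - p%:R + b).
  by rewrite /sigma betaE -natr1; field; apply/andP; split; [rewrite gt_eqF|rewrite lt_eqF]; lra.
have n0 : 0 < p.+1%:R :> R by rewrite ltr0n.
have sig0 : 0 < sigma by rewrite sigmaE !mulr_gt0 ?invr_gt0.
(* Here [q > n - 1] enters: this inequality gives [tau ^+ n < 1/2], on which the separation of the
   image rests. *)
have sig_lt : sigma < p.+1%:R.
  by rewrite sigmaE ltr_pdivrMr// ltr_pM2l//; lra.
have sigE : p.+1%:R / sigma = 1 + (q - p%:R) / b.
  by rewrite sigmaE; field; rewrite !gt_eqF.
have J_gt0 := Jseq_gt0 b; have M_succ := Mseq_succ b.
have M_lower := Mseq_lower b; have M_upper := Mseq_upper b0; have J_ge := Jseq_ge b.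
(* The explicit sequences are forgotten; the recursion and the growth bounds carry the rest. *)
move: (Jseq b) (Mseq b) J_gt0 M_succ M_lower M_upper J_ge => J M J_gt0 M_succ M_lower M_upper J_ge.
have [lam Hlam] := lebesgue_Rn_exists R p.+1.
exists (@umap R p J M (sseq sigma)), (range (fun w => @line R p (pos R M w))).
split; last split; last split; last split.
- apply: (umap_V1A Hlam J_gt0 M_succ (sseq_gt0 sigma) (target_t_lt sig0 sig_lt)
    (sseq_decr sig0 p.+1)) => //.
  + exact: (esize_summable sig0 b0 q_gt sigE).
  + exact: (energy_finite sig0 b0 q_gt sigE).
- exact: embed_compact.
- apply: (source_hausdorff_gt0 p b0 gvarphi c0 r00 J_gt0 M_succ M_upper) => r rr.
  by have [] := Hvarphi r rr; rewrite betaE.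
- apply: (source_hausdorff_lty p b0 gvarphi c0 r00 J_gt0 M_succ M_lower) => r rr.
  by have [] := Hvarphi r rr; rewrite betaE.
- rewrite image_comp.
  apply: (target_hausdorff sig0 sig_lt J_gt0 M_succ gphi c0' r00' _ mu_gt) => r rr.
  by have [] := Hphi r rr.
Qed.
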